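(* Let $G=(V,E,a,b)$ be a finite connected graph with Hermitian edge weights $a$ and real potential $b$, let $\mathcal T$ be its universal cover with periodic Jacobi operator $A_{\mathcal T}$, let $\mu$ be the density of states of $A_{\mathcal T}$, and let $\lambda\in\operatorname{Spec}_p A_{\mathcal T}$. Let $X_\lambda(G)$ be the Aomoto set of $G$ associated to $\lambda$. Then: (i) The subgraph of $G$ induced by $X_\lambda(G)$ is acyclic. (ii) $\lambda$ is an eigenvalue, with multiplicity one, of the induced Jacobi operator of each connected component of this subgraph. (iii) The density of states of $A_{\mathcal T}$ satisfies $$\mu\{\lambda\}=\frac{I_\lambda(G)}{|V(G)|},\qquad I_\lambda(G)=\mathsf{cc}\,X_\lambda(G)-|\partial X_\lambda(G)|.$$
   Context: Graphs. A graph $G=(V,E,a,b)$ (self-loops and multi-edges allowed) has a vertex set $V$, a set $E$ of directed edges with a fixed-point-free direction-reversing involution $e\mapsto\check e$, source and terminal maps $\sigma,\tau:E\to V$ with $\sigma(e)=\tau(\check e)$, edge weights $a:E\to\mathbb C$ and potential $b$ on $V$. For a vertex $u$, $\tau(u)$ also denotes the set of directed edges with terminal $u$. Weights and potential are Hermitian: $\overline{a_e}=a_{\check e}$ for all $e$, and $b:V\to\mathbb R$. A non-backtracking walk is a sequence of edges $e_1,\dots,e_\ell$ with $\tau(e_s)=\sigma(e_{s+1})$ and $e_s\ne\check e_{s+1}$ for $1\le s\le \ell-1$. A graph is acyclic if it has no closed non-backtracking walk (so an acyclic graph has no self-loops or multi-edges and its connected components are trees). Universal cover. For $G$ connected, the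 universal cover $\mathcal T=(\mathcal V,\mathcal E,\mathscr a,\mathscr b)$ is the (unique up to isomorphism) tree covering every cover of $G$; concretely, its vertices are the non-backtracking walks in $G$ starting at a fixed root (including the empty walk), two walks being joined by an edge (in both directions) when one extends the other by one edge. The covering map is $\Xi:\mathcal T\to G$, and $\mathscr a_{\tilde e}=a_{\Xi(\tilde e)}$, $\mathscr b_{\tilde v}=b_{\Xi(\tilde v)}$. (If $G$ is acyclic, $\mathcal T=G$.) Jacobi operators. $A_G$ acts on $\ell^2(V)$ by $(A_G\eta)(u)=b_u\eta(u)+\sum_{e\in\tau(u)}a_e\,\eta(\sigma(e))$; $A_{\mathcal T}$ is the bounded self-adjoint operator on $\ell^2(\mathcal V)$ given by the same formula on $\mathcal T$. The induced Jacobi operator of a subgraph is the Jacobi operator of that subgraph with the inherited weights and potential. The point spectrum is $\operatorname{Spec}_pA_{\mathcal T}=\{\lambda\in\mathbb R:\operatorname{Ker}(\lambda-A_{\mathcal T})\ne\{0\}\}$, with kernels taken in $\ell^2(\mathcal V)$. Spectral measures. For $u\in V$, $\mu_u$ is the spectral measure with $\langle\delta_{\tilde u},f(A_{\mathcal T})\delta_{\tilde u}\rangle=\int f\,d\mu_u$ for every $\tilde u\in\Xi^{-1}(u)$ and every bounded measurable $f$. The density of states is $\mu=\frac1{|V|}\sum_{u\in V}\mu_u$. Aomoto set. For $\lambda\in\operatorname{Spec}_pA_{\mathcal T}$, $X_\lambda(G)=\{u\in V:\mu_u\{\lambda\}>0\}$; equivalently, $u\in X_\lambda(G)$ iff for every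 $\tilde u\in\Xi^{-1}(u)$ there is $\zeta\in\operatorname{Ker}(\lambda-A_{\mathcal T})$ with $\zeta(\tilde u)\neq0$. The subgraph induced by $X\subset V$ contains all edges of $G$ with both ends in $X$; $\mathsf{cc}\,X$ is its number of connected components; $\partial X$ is the set of vertices outside $X$ joined to $X$ by an edge.
   Formalization: All edge weights are assumed nonzero; with zero weights (i) fails, e.g. for one vertex with a single self-loop of weight 0 and potential 0, where λ=0 gives X_λ(G)=V, which contains a loop. *)

(* Defs.v *)
From HB Require Import structures.
From mathcomp Require Import all_boot all_order all_algebra.
From mathcomp Require Import all_classical all_reals all_analysis.
From mathcomp Require Import vector complex.

Set Implicit Arguments.
Unset Strict Implicit.
Unset Printing Implicit Defensive.

Import Order.TTheory GRing.Theory Num.Theory.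
Import numFieldNormedType.Exports.

Local Open Scope classical_set_scope.
Local Open Scope ring_scope.
Local Open Scope complex_scope.

(* [E] is the type of directed edges; [ginv] reverses direction. Self-loops and
   multi-edges are allowed, and each undirected edge counts as two elements of
   [E]. *)
Record jgraph (R : realType) (V E : choiceType) := JGraph {
  ginv : E -> E;
  gsrc : E -> V;
  gtgt : E -> V;
  gwt : E -> R[i];
  gpot : V -> R;
  ginvK : involutive ginv;
  ginv_neq : forall e, ginv e != e;
  gsrcE : forall e, gsrc e = gtgt (ginv e);
  gwt_herm : forall e, (gwt e)^* = gwt (ginv e)
}.

Section Graphs.
Variables (R : realType) (V E : choiceType) (G : jgraph R V E).

Definition nb_step : rel E :=
  fun e f => (gtgt G e == gsrc G f) && (e != ginv G f).

Definition nb_walk (r : V) (p : seq E) : bool :=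
  if p is e :: q then (gsrc G e == r) && path nb_step e q else true.

Definition walk_end (r : V) (p : seq E) : V := last r (map (gtgt G) p).

Definition acyclic : Prop :=
  ~ exists e p, path nb_step e p /\ gtgt G (last e p) = gsrc G e.

(* The sum is a finitely supported sum; it is the intended one whenever every
   vertex has finitely many incident edges. *)
Definition jacobi (eta : V -> R[i]) (u : V) : R[i] :=
  (gpot G u)%:C * eta u
  + \sum_(e \in [set e | gtgt G e = u]) gwt G e * eta (gsrc G e).

End Graphs.

Section Induced.
Variables (R : realType) (V E : choiceType) (G : jgraph R V E) (X : {pred V}).

Definition induced_vertex := {v : V | v \in X}.
Definition induced_edge := {e : E | (gsrc G e \in X) && (gtgt G e \in X)}.

Fact induced_src_subproof (e : induced_edge) : gsrc G (val e) \in X.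
Proof. by case/andP: (valP e). Qed.

Fact induced_tgt_subproof (e : induced_edge) : gtgt G (val e) \in X.
Proof. by case/andP: (valP e). Qed.

Fact induced_inv_subproof (e : induced_edge) :
  (gsrc G (ginv G (val e)) \in X) && (gtgt G (ginv G (val e)) \in X).
Proof.
by rewrite gsrcE ginvK -gsrcE induced_src_subproof induced_tgt_subproof.
Qed.

Definition induced_src (e : induced_edge) : induced_vertex :=
  exist (fun v => v \in X) _ (induced_src_subproof e).
Definition induced_tgt (e : induced_edge) : induced_vertex :=
  exist (fun v => v \in X) _ (induced_tgt_subproof e).
Definition induced_inv (e : induced_edge) : induced_edge :=
  exist (fun e => (gsrc G e \in X) && (gtgt G e \in X)) _
    (induced_inv_subproof e).

Fact induced_invK : involutive induced_inv.
Proof. by move=> e; apply: val_inj; exact: ginvK. Qed.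

Fact induced_inv_neq e : induced_inv e != e.
Proof. by rewrite -val_eqE; exact: ginv_neq. Qed.

Fact induced_srcE e : induced_src e = induced_tgt (induced_inv e).
Proof. by apply: val_inj; exact: gsrcE. Qed.

Definition induced_graph : jgraph R induced_vertex induced_edge :=
  @JGraph R induced_vertex induced_edge induced_inv induced_src induced_tgt
    (fun e => gwt G (val e)) (fun v => gpot G (val v))
    induced_invK induced_inv_neq induced_srcE
    (fun e => gwt_herm G (val e)).

End Induced.

Section FiniteGraphs.
Variables (R : realType) (V E : finType) (G : jgraph R V E).

Definition adjacent : rel V :=
  fun u v => [exists e, (gsrc G e == u) && (gtgt G e == v)].

Definition gconnected : Prop := forall u v, connect adjacent u v.

Definition components : {set {set V}} :=
  equivalence_partition (connect adjacent) [set: V]%SET.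

Definition boundary (X : {set V}) : {set V} :=
  [set v | (v \notin X) && [exists u in X, adjacent u v]]%SET.

Definition jacobi_ffun (eta : {ffun V -> R[i]^o}) : {ffun V -> R[i]^o} :=
  [ffun u => jacobi G eta u].

Fact jacobi_ffun_is_linear : linear jacobi_ffun.
Proof.
move=> c f g; apply/ffunP => u; rewrite !ffunE /jacobi.
have fE : finite_set [set e | gtgt G e = u] by exact: finite_finset.
rewrite !(fsbig_finite _ _ fE) /= ?ffunE !scalerDr addrACA; congr (_ + _).
  by rewrite mulrDr; congr (_ + _); rewrite /GRing.scale /= mulrCA.
rewrite scaler_sumr -big_split /=; apply: eq_bigr => e _.
by rewrite !ffunE mulrDr; congr (_ + _); rewrite /GRing.scale /= mulrCA.
Qed.

HB.instance Definition _ :=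
  GRing.isLinear.Build R[i] {ffun V -> R[i]^o} {ffun V -> R[i]^o} *:%R
    jacobi_ffun jacobi_ffun_is_linear.

(* The operator is Hermitian, so geometric and algebraic multiplicities agree. *)
Definition multiplicity (lam : R) : nat :=
  \dim (passmx.leigenspace (linfun jacobi_ffun) lam%:C).

End FiniteGraphs.

Section Cover.
Variables (R : realType) (V E : choiceType) (G : jgraph R V E) (r : V).

Definition cover_vertex := {p : seq E | nb_walk G r p}.

(* ((p, e), true) is the edge from the walk p to its extension p e, and
   ((p, e), false) is the same edge travelled backwards. *)
Definition cover_edge :=
  ({pe : seq E * E | nb_walk G r (rcons pe.1 pe.2)} * bool)%type.

Fact nb_walk_rcons p e : nb_walk G r (rcons p e) -> nb_walk G r p.
Proof.
by case: p => [//|f p] /=; rewrite rcons_path => /and3P[-> ->].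
Qed.

Definition cover_short (x : cover_edge) : cover_vertex :=
  exist (nb_walk G r) _ (nb_walk_rcons (valP x.1)).
Definition cover_long (x : cover_edge) : cover_vertex :=
  exist (nb_walk G r) _ (valP x.1).

Definition cover_src (x : cover_edge) : cover_vertex :=
  if x.2 then cover_short x else cover_long x.
Definition cover_tgt (x : cover_edge) : cover_vertex :=
  if x.2 then cover_long x else cover_short x.
Definition cover_inv (x : cover_edge) : cover_edge := (x.1, ~~ x.2).

Definition cover_vmap (p : cover_vertex) : V := walk_end G r (val p).
Definition cover_emap (x : cover_edge) : E :=
  if x.2 then (val x.1).2 else ginv G (val x.1).2.

Fact cover_invK : involutive cover_inv.
Proof. by case=> x b; rewrite /cover_inv /= negbK. Qed.

Fact cover_inv_neq x : cover_inv x != x.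
Proof. by case: x => x []; apply/eqP; rewrite /cover_inv => -[]. Qed.

Fact cover_srcE x : cover_src x = cover_tgt (cover_inv x).
Proof. by case: x => x []. Qed.

Fact cover_wt_herm x :
  (gwt G (cover_emap x))^* = gwt G (cover_emap (cover_inv x)).
Proof. by rewrite gwt_herm; case: x => x [] //=; rewrite /cover_emap /= ginvK. Qed.

Definition universal_cover : jgraph R cover_vertex cover_edge :=
  @JGraph R cover_vertex cover_edge cover_inv cover_src cover_tgt
    (fun x => gwt G (cover_emap x)) (fun v => gpot G (cover_vmap v))
    cover_invK cover_inv_neq cover_srcE cover_wt_herm.

End Cover.

Section SquareSummable.
Variables (R : realType) (T : choiceType).
Implicit Types (f g : T -> R[i]) (F : T -> R).

Definition sqmod (z : R[i]) : R := complex.Re z ^+ 2 + complex.Im z ^+ 2.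

Definition l2 f : Prop := summable [set: T] (fun v => (sqmod (f v))%:E).

Definition l2norm f : R :=
  Num.sqrt (fine (\esum_(v in [set: T]) (sqmod (f v))%:E)).

(* Unconditional sum of an absolutely summable real family. *)
Definition rsum F : R :=
  fine (\esum_(v in [set: T]) (Num.max (F v) 0)%:E)
  - fine (\esum_(v in [set: T]) (Num.max (- F v) 0)%:E).

Definition inner f g : R[i] :=
  (rsum (fun v => complex.Re ((f v)^* * g v)))
  +i* (rsum (fun v => complex.Im ((f v)^* * g v))).

Definition delta (v : T) : T -> R[i] := fun w => (w == v)%:R.

End SquareSummable.

Definition bounded_borel (R : realType) (f : R -> R) : Prop :=
  measurable_fun [set: R] f /\ exists M : R, forall t, `|f t| <= M.

Section Spectral.
Variables (R : realType) (T : choiceType).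
Implicit Types (A : (T -> R[i]) -> T -> R[i]) (f g : R -> R) (x y : T -> R[i]).

Definition point_spectrum A (lam : R) : Prop :=
  exists x, [/\ l2 x, exists v, x v != 0 & forall v, A x v = lam%:C * x v].

(* [Phi f] is f(A) for a bounded self-adjoint A and a bounded Borel f : R -> R.
   Operators are given on all functions T -> R[i]; only their action on square
   summable ones is constrained. The last clause says f(A) = A as soon as f is
   the identity on an interval [-M, M] with M at least the norm of A; with the
   others it determines Phi, since it forces f(A) to ignore the values of f
   outside that interval. *)
Record borel_calculus A (Phi : (R -> R) -> (T -> R[i]) -> T -> R[i]) : Prop :=
  BorelCalculus {
  bc_l2 : forall f x, bounded_borel f -> l2 x -> l2 (Phi f x);
  bc_linear : forall f (c : R[i]) x y, bounded_borel f -> l2 x -> l2 y ->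
    forall v, Phi f (fun w => c * x w + y w) v = c * Phi f x v + Phi f y v;
  bc_norm : forall f (M : R) x, bounded_borel f -> (forall t, `|f t| <= M) ->
    l2 x -> l2norm (Phi f x) <= M * l2norm x;
  bc_selfadjoint : forall f x y, bounded_borel f -> l2 x -> l2 y ->
    inner (Phi f x) y = inner x (Phi f y);
  bc_one : forall x, l2 x -> forall v, Phi (fun=> 1) x v = x v;
  bc_lin : forall f g (c : R) x, bounded_borel f -> bounded_borel g -> l2 x ->
    forall v, Phi (fun t => c * f t + g t) x v = c%:C * Phi f x v + Phi g x v;
  bc_mul : forall f g x, bounded_borel f -> bounded_borel g -> l2 x ->
    forall v, Phi (fun t => f t * g t) x v = Phi f (Phi g x) v;
  bc_cvg : forall (F : nat -> R -> R) f (M : R) x,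
    (forall n, bounded_borel (F n)) -> bounded_borel f ->
    (forall n t, `|F n t| <= M) ->
    (forall t, (fun n => F n t) @ \oo --> f t) -> l2 x ->
    (fun n => l2norm (fun v => Phi (F n) x v - Phi f x v)) @ \oo --> (0 : R);
  bc_id : forall f (M : R) x, bounded_borel f ->
    (forall y, l2 y -> l2 (A y) /\ l2norm (A y) <= M * l2norm y) ->
    (forall t, - M <= t <= M -> f t = t) -> l2 x ->
    forall v, Phi f x v = A x v
}.

(* Taking f = 1 shows that such a measure has mass 1, so each real integral
   below is that of an integrable function. *)
Definition spectral_measure (Phi : (R -> R) -> (T -> R[i]) -> T -> R[i])
    (v : T) (m : {measure set R -> \bar R}) : Prop :=
  forall f, bounded_borel f ->
    inner (delta R v) (Phi f (delta R v)) = (\int[m]_t f t)%:C.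

End Spectral.

Section Aomoto.
Variables (R : realType) (V E : finType) (G : jgraph R V E).
Variable mu : V -> {measure set R -> \bar R}.

Definition density_of_states (B : set R) : \bar R :=
  ((#|V|%:R^-1)%:E * \sum_(u : V) mu u B)%E.

Definition aomoto (lam : R) : {set V} :=
  [set u | (0 < mu u [set lam]%classic)%E]%SET.

Definition aomoto_index (lam : R) : int :=
  #|components (induced_graph G (aomoto lam))|%:Z
  - #|boundary G (aomoto lam)|%:Z.

End Aomoto.

(* Main.v *)
Require Import Defs.
From HB Require Import structures.
From mathcomp Require Import all_boot all_order all_algebra.
From mathcomp Require Import all_classical all_reals all_analysis.
From mathcomp Require Import vector complex.
From mathcomp Require Import ring lra zify.
Set Implicit Arguments.
Unset Strict Implicit.
Unset Printing Implicit Defensive.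
Import Order.TTheory GRing.Theory Num.Theory.
Import numFieldNormedType.Exports.
Local Open Scope classical_set_scope.
Local Open Scope ring_scope.
Local Open Scope complex_scope.

(* Let K be the kernel of lam - A on the cover T and P the projection onto it; the
   functions xi_p = P delta_p reproduce K, and xi_p(p) = mu_u{lam} =: m(u) for p
   above u, so K vanishes off the lift X~ of the Aomoto set X.

   Removing an edge (p, q) of T leaves two branches. Testing z in K against the
   truncation of z' in K to a branch, self-adjointness gives
     z(p)^* a_qp z'(q) = z(q)^* a_pq z'(p).
   Hence for p, q in X~ there is c with z(q) = c z(p) for all z in K, and
   |c|^2 = m(q) / m(p). So |xi_p|^2 is bounded below on the component of p in X~,
   which is therefore finite: X is acyclic. A component C of X lifts to T, any
   element of K nonzero on the lift restricts to an eigenfunction of C, and the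
   same identity, applied to the lift of an arbitrary eigenfunction of C extended
   by 0, shows that it is unique up to a factor.

   For the index, let M(e) be the fraction of the mass |xi_p|^2 that lies beyond
   the edge e leaving p; by deck transformations it depends only on the image of e
   in G. Splitting T at p gives sum_{e leaving u} M(e) = 1 - m(u) for u in X.
   Splitting T at an edge e inside X gives M(e) + M(e^-1) = 1, since xi_p and xi_q
   are proportional. For v in the boundary of X the masses M of the edges from X
   to v add up to 1: truncating xi_q to the branch of q away from v yields, after
   normalization, a solution of (A - lam) z = delta_v, and one evaluates at v the
   equation satisfied by z - P z, which does not depend on q. Summing,
     |X| - sum m = |E(X)| + |boundary X|,
   and |X| - |E(X)| = cc X because X is a forest. *)

(** * Square-summable functions *)

Section SquareSummableTheory.
Variables (R : realType) (T : choiceType).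
Implicit Types (x y z : T -> R[i]) (F H A B : T -> R) (c : R[i]) (v w : T).

Lemma sqmod_ge0 (a : R[i]) : 0 <= sqmod a.
Proof. by rewrite addr_ge0 // sqr_ge0. Qed.

Lemma sqmod_eq0 (a : R[i]) : sqmod a = 0 -> a = 0.
Proof.
case: a => a b; rewrite /sqmod /= => h.
have a0 : a = 0 by nra.
have b0 : b = 0 by nra.
by rewrite a0 b0.
Qed.

Lemma sqmodM (a b : R[i]) : sqmod (a * b) = sqmod a * sqmod b.
Proof. by case: a => a a'; case: b => b b'; rewrite /sqmod /=; ring. Qed.

Lemma sqmodD_le (a b : R[i]) : sqmod (a + b) <= 2 * (sqmod a + sqmod b).
Proof.
case: a => a a'; case: b => b b'; rewrite /sqmod /= -subr_ge0.
rewrite (_ : _ - _ = (a - b) ^+ 2 + (a' - b') ^+ 2); last by ring.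
by rewrite addr_ge0 ?sqr_ge0.
Qed.

Lemma sqmod_conj (a : R[i]) : sqmod a^*%R = sqmod a.
Proof. by case: a => a a'; rewrite /sqmod /=; ring. Qed.

Lemma mul_conj_sqmod (a : R[i]) : a^* * a = (sqmod a)%:C.
Proof.
by case: a => a a'; apply/eqP; rewrite /sqmod eq_complex /=; apply/andP; split; apply/eqP; ring.
Qed.

Definition nnsum (S : set T) F : \bar R := \esum_(v in S) (F v)%:E.

Definition abs_summable F := (nnsum [set: T] (fun v => `|F v|%R) < +oo)%E.

Lemma nnsum_ge0 S F : (forall v, 0 <= F v) -> (0 <= nnsum S F)%E.
Proof. by move=> F0; apply: esum_ge0 => v _; rewrite lee_fin. Qed.

Lemma nnsum_fin S F : (forall v, 0 <= F v) -> (nnsum S F < +oo)%E ->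
  nnsum S F \is a fin_num.
Proof. by move=> F0 h; rewrite ge0_fin_numE // nnsum_ge0. Qed.

Lemma nnsumD S F H : (forall v, 0 <= F v) -> (forall v, 0 <= H v) ->
  nnsum S (fun v => F v + H v) = (nnsum S F + nnsum S H)%E.
Proof.
move=> F0 H0; rewrite /nnsum -esumD; try by move=> v _; rewrite lee_fin.
by apply: eq_esum => v _; rewrite EFinD.
Qed.

Lemma nnsum_le S F H : (forall v, F v <= H v) -> (nnsum S F <= nnsum S H)%E.
Proof. by move=> FH; apply: le_esum => v _; rewrite lee_fin. Qed.

Lemma nnsum_finE S (D : seq T) F : uniq D -> (forall v, S v <-> v \in D) ->
  (forall v, 0 <= F v) -> nnsum S F = (\sum_(v <- D) F v)%:E.
Proof.
move=> uD SD F0.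
have -> : S = [set` D] by apply/seteqP; split=> v /=; rewrite SD.
rewrite /nnsum esum_fset //; last by move=> v _; rewrite lee_fin.
rewrite -fsbig_seq // sumEFin //.
Qed.

Lemma nnsumZ S F (c : R) : 0 <= c -> (forall v, 0 <= F v) ->
  nnsum S (fun v => c * F v) = (c%:E * nnsum S F)%E.
Proof.
move=> c0 F0; rewrite /nnsum /esum -ereal_supZl //; last first.
  by apply/set0P; exists 0%E; exists set0; [exact: fsets_set0|rewrite fsbig_set0].
congr ereal_sup; rewrite [RHS]image_comp; congr (_ @` _); apply/funext => D /=.
by rewrite ge0_mule_fsumr // => v; rewrite lee_fin.
Qed.

Lemma nnsum_ge_seq S (D : seq T) F : uniq D -> (forall v, v \in D -> S v) ->
  (forall v, 0 <= F v) -> ((\sum_(v <- D) F v)%:E <= nnsum S F)%E.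
Proof.
move=> uD DS F0; apply: esum_ge; exists [set` D].
  by split=> // v /=; exact: DS.
by rewrite -fsbig_seq // sumEFin.
Qed.

Definition posp F v := Num.max (F v) 0.
Definition negp F v := Num.max (- F v) 0.

Lemma posp_ge0 F v : 0 <= posp F v. Proof. by rewrite le_max lexx orbT. Qed.

Lemma negp_ge0 F v : 0 <= negp F v. Proof. by rewrite le_max lexx orbT. Qed.

Lemma pospBnegp F v : F v = posp F v - negp F v.
Proof.
rewrite /posp /negp; case: (leP 0 (F v)) => h.
  by rewrite max_r ?subr0 // oppr_le0.
by rewrite max_l ?oppr_ge0 ?(ltW h) // opprK add0r.
Qed.

(** Frees [rsum] from the canonical positive and negative parts: summing [posp F + B = negp F + A]
    and cancelling finite sums allows any decomposition of [F] into nonnegative summable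
    families. *)
Lemma rsumE A B F : (forall v, 0 <= A v) -> (forall v, 0 <= B v) ->
  (nnsum setT A < +oo)%E -> (nnsum setT B < +oo)%E ->
  (forall v, F v = A v - B v) ->
  rsum F = fine (nnsum setT A) - fine (nnsum setT B).
Proof.
move=> A0 B0 sA sB FE; rewrite /rsum -/(nnsum _ (posp F)) -/(nnsum _ (negp F)).
have P0 := @posp_ge0 F; have N0 := @negp_ge0 F.
have PA v : posp F v <= A v by rewrite /posp FE ge_max A0 andbT gerBl.
have NB v : negp F v <= B v by rewrite /negp FE opprB ge_max B0 andbT gerBl.
have sP : (nnsum setT (posp F) < +oo)%E by apply: le_lt_trans sA; apply: nnsum_le.
have sN : (nnsum setT (negp F) < +oo)%E by apply: le_lt_trans sB; apply: nnsum_le.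
have : (nnsum setT (posp F) + nnsum setT B = nnsum setT (negp F) + nnsum setT A)%E.
  rewrite -!nnsumD //; congr nnsum; apply/funext => v.
  by have := FE v; rewrite [in X in X -> _]pospBnegp; lra.
move/(congr1 fine); rewrite !fineD ?nnsum_fin //; lra.
Qed.

Lemma abs_summable_posp F : abs_summable F -> (nnsum setT (posp F) < +oo)%E.
Proof.
apply: le_lt_trans; apply: nnsum_le => v.
by rewrite /posp ge_max normr_ge0 ler_norm.
Qed.

Lemma abs_summable_negp F : abs_summable F -> (nnsum setT (negp F) < +oo)%E.
Proof.
apply: le_lt_trans; apply: nnsum_le => v.
by rewrite /negp ge_max normr_ge0 -normrN ler_norm.
Qed.

Lemma nnsumD_lty F H : (forall v, 0 <= F v) -> (forall v, 0 <= H v) ->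
  (nnsum setT F < +oo)%E -> (nnsum setT H < +oo)%E ->
  (nnsum setT (fun v => (F v + H v)%R) < +oo)%E.
Proof. by move=> F0 H0 sF sH; rewrite nnsumD // lte_add_pinfty. Qed.

Lemma nnsumZ_lty F (c : R) : 0 <= c -> (forall v, 0 <= F v) ->
  (nnsum setT F < +oo)%E -> (nnsum setT (fun v => (c * F v)%R) < +oo)%E.
Proof.
move=> c0 F0 sF; rewrite nnsumZ //.
by rewrite -(fineK (nnsum_fin F0 sF)) -EFinM ltry.
Qed.

Lemma rsumD F H : abs_summable F -> abs_summable H ->
  rsum (fun v => F v + H v) = rsum F + rsum H.
Proof.
move=> sF sH.
have sFp := abs_summable_posp sF. have sFn := abs_summable_negp sF.
have sHp := abs_summable_posp sH. have sHn := abs_summable_negp sH.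
have [pF nF] := (@posp_ge0 F, @negp_ge0 F).
have [pH nH] := (@posp_ge0 H, @negp_ge0 H).
rewrite (@rsumE (fun v => posp F v + posp H v) (fun v => negp F v + negp H v));
  try (by move=> v; rewrite addr_ge0); try exact: nnsumD_lty; last first.
  by move=> v; rewrite {1}pospBnegp [in LHS](pospBnegp H); ring.
rewrite !nnsumD // !fineD ?nnsum_fin //.
by rewrite /rsum -/(nnsum setT (posp F)) -/(nnsum setT (negp F))
  -/(nnsum setT (posp H)) -/(nnsum setT (negp H)); ring.
Qed.

Lemma rsumN F : rsum (fun v => - F v) = - rsum F.
Proof.
rewrite /rsum opprB; congr (_ - _).
by congr (fine _); apply: eq_esum => v _; rewrite opprK.
Qed.

Lemma rsumZ F (c : R) : abs_summable F -> rsum (fun v => c * F v) = c * rsum F.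
Proof.
move=> sF; wlog c0 : c / 0 <= c.
  move=> H; case: (leP 0 c) => [/H//|/ltW]; rewrite -oppr_ge0 => /H.
  have -> : (fun v => - c * F v) = (fun v => - (c * F v)).
    by apply/funext => v; rewrite mulNr.
  by rewrite rsumN mulNr => /oppr_inj.
have sFp := abs_summable_posp sF. have sFn := abs_summable_negp sF.
have [pF nF] := (@posp_ge0 F, @negp_ge0 F).
rewrite (@rsumE (fun v => c * posp F v) (fun v => c * negp F v));
  try (by move=> v; rewrite mulr_ge0); try exact: nnsumZ_lty; last first.
  by move=> v; rewrite {1}pospBnegp mulrBr.
rewrite !nnsumZ // -(fineK (nnsum_fin pF sFp)) -(fineK (nnsum_fin nF sFn)) /=.
by rewrite -mulrBr.
Qed.

Lemma rsum_nneg F : (forall v, 0 <= F v) -> rsum F = fine (nnsum setT F).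
Proof.
move=> F0; rewrite /rsum.
have -> : (fun v => (Num.max (F v) 0)%:E) = (fun v => (F v)%:E).
  by apply/funext => v; rewrite (max_idPl _).
rewrite [X in _ - fine X](_ : _ = 0%E) ?subr0 //.
by apply: esum1 => v _; rewrite (max_idPr _) // oppr_le0.
Qed.

Lemma l2E x : l2 x <-> (nnsum setT (@sqmod R \o x) < +oo)%E.
Proof.
rewrite /l2 /summable (_ : \esum_(_ in _) _ = nnsum setT (@sqmod R \o x)) //.
by apply: eq_esum => v _ /=; rewrite ger0_norm // sqmod_ge0.
Qed.

Lemma l2_le x F : (nnsum setT F < +oo)%E -> (forall v, sqmod (x v) <= F v) ->
  l2 x.
Proof. by move=> sF xF; apply/l2E; apply: le_lt_trans sF; exact: nnsum_le. Qed.

Lemma l2_sqmod x y : l2 x -> (forall v, sqmod (y v) <= sqmod (x v)) -> l2 y.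
Proof. by move/l2E => sx; exact: l2_le. Qed.

Lemma l2D x y : l2 x -> l2 y -> l2 (fun v => x v + y v).
Proof.
move=> /l2E sx /l2E sy.
apply: (@l2_le _ (fun v => 2 * (sqmod (x v) + sqmod (y v)))) => [|v].
  apply: nnsumZ_lty => // [v|]; first by rewrite addr_ge0 ?sqmod_ge0.
  by apply: nnsumD_lty => // v; exact: sqmod_ge0.
exact: sqmodD_le.
Qed.

Lemma l2Z c x : l2 x -> l2 (fun v => c * x v).
Proof.
move=> /l2E sx; apply: (@l2_le _ (fun v => sqmod c * sqmod (x v))) => [|v].
  by apply: nnsumZ_lty => // [|v]; exact: sqmod_ge0.
by rewrite sqmodM.
Qed.

Lemma l2_fin (D : seq T) x : (forall v, v \notin D -> x v = 0) -> l2 x.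
Proof.
move=> xD; apply/l2E.
have -> : nnsum setT (@sqmod R \o x) = nnsum [set` undup D] (@sqmod R \o x).
  rewrite /nnsum [RHS]esum_mkcond; apply: eq_esum => v _.
  rewrite mem_setE mem_undup; case: ifPn => // vD /=; rewrite xD //.
  by rewrite /sqmod /= expr0n /= addr0.
rewrite (@nnsum_finE _ (undup D)) ?ltry ?undup_uniq // => v; exact: sqmod_ge0.
Qed.

Lemma l2_delta v : l2 (Defs.delta R v).
Proof.
by apply: (@l2_fin [:: v]) => w; rewrite inE /Defs.delta => /negbTE ->.
Qed.

Definition restrict (S : set T) x v : R[i] := if `[< S v >] then x v else 0.

Lemma l2_restrict S x : l2 x -> l2 (restrict S x).
Proof.
move=> lx; apply: l2_sqmod lx _ => v; rewrite /restrict; case: ifP => // _.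
by rewrite {1}/sqmod /= expr0n /= addr0 sqmod_ge0.
Qed.

Lemma normM_le (a b : R) : `|a * b| <= a ^+ 2 + b ^+ 2.
Proof.
rewrite normrM -(real_normK (num_real a)) -(real_normK (num_real b)) -subr_ge0.
rewrite (_ : _ - _ = (`|a| - `|b|) ^+ 2 + `|a| * `|b|); last by ring.
by rewrite addr_ge0 ?sqr_ge0 ?mulr_ge0.
Qed.

Lemma abs_summable_Re x y : l2 x -> l2 y ->
  abs_summable (fun v => complex.Re ((x v)^* * y v)).
Proof.
move=> /l2E sx /l2E sy.
apply: (@le_lt_trans _ _ (nnsum setT (fun v => sqmod (x v) + sqmod (y v)))).
  apply: nnsum_le => v; case: (x v) => a a'; case: (y v) => b b' /=.
  apply: le_trans (ler_normB _ _) _; rewrite mulNr normrN /sqmod /=.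
  by have := normM_le a b; have := normM_le a' b'; lra.
by apply: nnsumD_lty => // v; exact: sqmod_ge0.
Qed.

Lemma abs_summable_Im x y : l2 x -> l2 y ->
  abs_summable (fun v => complex.Im ((x v)^* * y v)).
Proof.
move=> /l2E sx /l2E sy.
apply: (@le_lt_trans _ _ (nnsum setT (fun v => sqmod (x v) + sqmod (y v)))).
  apply: nnsum_le => v; case: (x v) => a a'; case: (y v) => b b' /=.
  apply: le_trans (ler_normD _ _) _; rewrite mulNr normrN /sqmod /=.
  by have := normM_le a b'; have := normM_le a' b; lra.
by apply: nnsumD_lty => // v; exact: sqmod_ge0.
Qed.

Lemma innerDr x y z : l2 x -> l2 y -> l2 z ->
  inner x (fun v => y v + z v) = inner x y + inner x z.
Proof.
move=> lx ly lz; rewrite /inner.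
transitivity ((rsum (fun v => complex.Re ((x v)^* * y v) + complex.Re ((x v)^* * z v)))
  +i* (rsum (fun v => complex.Im ((x v)^* * y v) + complex.Im ((x v)^* * z v)))).
  by congr (_ +i* _); congr rsum; apply/funext => v; rewrite mulrDr raddfD.
by rewrite (rsumD (abs_summable_Re lx ly) (abs_summable_Re lx lz))
  (rsumD (abs_summable_Im lx ly) (abs_summable_Im lx lz)).
Qed.

Lemma inner_conj x y : inner y x = (inner x y)^*%R.
Proof.
rewrite -[RHS]/(conjc _).
rewrite /inner /= -rsumN; congr (_ +i* _); congr rsum; apply/funext => v;
  case: (x v) => a a'; case: (y v) => b b' /=; ring.
Qed.

Lemma innerZr c x y : l2 x -> l2 y ->
  inner x (fun v => c * y v) = c * inner x y.
Proof.
case: c => c c' lx ly; rewrite /inner.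
have sR := abs_summable_Re lx ly; have sI := abs_summable_Im lx ly.
have Z (d : R) F : abs_summable F -> abs_summable (fun v => d * F v).
  move=> sF; rewrite /abs_summable (_ : (fun v => `|d * F v|) = (fun v => `|d| * `|F v|)).
    by apply: nnsumZ_lty.
  by apply/funext => v; rewrite normrM.
transitivity ((rsum (fun v => c * complex.Re ((x v)^* * y v)
    + (- c') * complex.Im ((x v)^* * y v)))
  +i* (rsum (fun v => c * complex.Im ((x v)^* * y v) + c' * complex.Re ((x v)^* * y v)))).
  congr (_ +i* _); congr rsum; apply/funext => v;
    case: (x v) => a a'; case: (y v) => b b' /=; ring.
rewrite (rsumD (Z c _ sR) (Z (- c') _ sI)) (rsumD (Z c _ sI) (Z c' _ sR)).
rewrite (rsumZ c sR) (rsumZ (- c') sI) (rsumZ c sI) (rsumZ c' sR).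
by apply/eqP; rewrite eq_complex /=; apply/andP; split; apply/eqP; ring.
Qed.

Lemma inner_ext x y y' : (forall v, (x v)^* * y v = (x v)^* * y' v) ->
  inner x y = inner x y'.
Proof. by move=> h; congr (_ +i* _); congr rsum; apply/funext => v; rewrite h. Qed.

Lemma inner0 x y : (forall v, (x v)^* * y v = 0) -> inner x y = 0.
Proof.
move=> h; rewrite (@inner_ext x y (fun=> 0)) => [|v]; last by rewrite h mulr0.
rewrite /inner; apply/eqP; rewrite eq_complex /=; apply/andP.
by split; rewrite rsum_nneg => [|v]; rewrite ?mulr0 //= /nnsum esum1 // => v _; rewrite mulr0.
Qed.

Lemma inner_delta x w : inner x (Defs.delta R w) = (x w)^*%R.
Proof.
have one H : (forall v, v != w -> H v = 0) -> (forall v, 0 <= H v) ->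
    nnsum setT H = (H w)%:E.
  move=> Hw H0; transitivity (nnsum [set w] H).
    rewrite /nnsum [RHS]esum_mkcond; apply: eq_esum => v _.
    have [->|vw] := eqVneq v w; first by rewrite mem_set.
    by rewrite Hw // if_same.
  by rewrite (@nnsum_finE _ [:: w]) //= ?big_seq1 // => v; rewrite inE; split=> [->|/eqP].
have oneR F : (forall v, v != w -> F v = 0) -> rsum F = F w.
  move=> Fw; rewrite [RHS]pospBnegp /rsum -/(nnsum _ (posp F)) -/(nnsum _ (negp F)).
  by rewrite !one => // [v|v|v|v]; rewrite ?posp_ge0 ?negp_ge0 // /posp /negp => /Fw ->;
     rewrite ?oppr0 maxxx.
rewrite /inner !oneR /Defs.delta ?eqxx ?mulr1 => [|v /negbTE ->|v /negbTE ->];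
  rewrite ?mulr0 //.
by case: (x w).
Qed.

Lemma inner_restrict S x :
  inner x (restrict S x) = (fine (nnsum S (@sqmod R \o x)))%:C.
Proof.
rewrite /inner; apply/eqP; rewrite eq_complex /=; apply/andP; split; apply/eqP.
  rewrite rsum_nneg => [|v].
    congr fine; rewrite /nnsum [RHS]esum_mkcond; apply: eq_esum => v _.
    by rewrite /restrict; case: asboolP => Sv;
      rewrite ?(mem_set Sv) ?(memNset Sv) ?mulr0 // mul_conj_sqmod.
  rewrite /restrict; case: ifP => _; rewrite ?mulr0 // mul_conj_sqmod.
  exact: sqmod_ge0.
rewrite rsum_nneg => [|v].
  rewrite /nnsum esum1 // => v _.
  by rewrite /restrict; case: ifP => _; rewrite ?mulr0 // mul_conj_sqmod.
by rewrite /restrict; case: ifP => _; rewrite ?mulr0 // mul_conj_sqmod.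
Qed.

Lemma inner_self x : inner x x = (fine (nnsum setT (@sqmod R \o x)))%:C.
Proof.
rewrite -inner_restrict; congr inner; apply/funext => v.
by rewrite /restrict; case: asboolP => // h; case: h.
Qed.

Lemma nnsum_bij (f : T -> T) S F : bijective f ->
  nnsum (f @^-1` S) (F \o f) = nnsum S F.
Proof.
move=> bf; rewrite /nnsum.
rewrite (@reindex_esum R _ _ (f @^-1` S) S f (fun v => (F v)%:E)) //.
case: bf => g fK gK; split=> [v //|u v _ _ /(can_inj fK) //|v Sv].
by exists (g v); rewrite /= ?gK.
Qed.

Lemma rsum_bij (f : T -> T) F : bijective f -> rsum (F \o f) = rsum F.
Proof.
move=> bf; rewrite /rsum -/(nnsum _ (posp F)) -/(nnsum _ (negp F)).
by rewrite -(nnsum_bij _ (posp F) bf) -(nnsum_bij _ (negp F) bf).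
Qed.

Lemma inner_bij (f : T -> T) x y : bijective f ->
  inner (x \o f) (y \o f) = inner x y.
Proof.
move=> bf; rewrite /inner; congr (_ +i* _).
  by rewrite -(rsum_bij (fun v => complex.Re ((x v)^* * y v)) bf).
by rewrite -(rsum_bij (fun v => complex.Im ((x v)^* * y v)) bf).
Qed.

Lemma l2_bij (f : T -> T) x : bijective f -> l2 x -> l2 (x \o f).
Proof.
by move=> bf /l2E lx; apply/l2E; rewrite -(nnsum_bij _ (@sqmod R \o x) bf) in lx.
Qed.

Lemma l2norm_eq0 x : l2 x -> l2norm x = 0 -> forall v, x v = 0.
Proof.
move=> /l2E lx /eqP; rewrite sqrtr_eq0 -/(nnsum setT (@sqmod R \o x)) => h v.
have x0 w : 0 <= (@sqmod R \o x) w by exact: sqmod_ge0.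
have := @nnsum_ge_seq setT [:: v] _ isT (fun _ _ => I) x0.
rewrite big_seq1 -(fineK (nnsum_fin x0 lx)) lee_fin => /le_trans/(_ h) /= xv.
by apply: sqmod_eq0; apply/eqP; rewrite eq_le xv x0.
Qed.

End SquareSummableTheory.

(** * Reduced words and walks *)

Section Words.
Variables (R : realType) (V E : choiceType) (G : jgraph R V E).
Implicit Types (u v : V) (e f : E) (w y q : seq E).

(* [last e w] is [e] for the empty word [w], and [e != ginv G e], so that no
   cancellation takes place in that case. *)
Definition wstep w e : seq E :=
  if last e w == ginv G e then take (size w).-1 w else rcons w e.

Definition wact w q := foldl wstep w q.

Definition winv w := rev (map (ginv G) w).

Fixpoint walk u q : bool :=
  if q is e :: q' then (gsrc G e == u) && walk (gtgt G e) q' else true.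

Lemma gtgt_inv e : gtgt G (ginv G e) = gsrc G e.
Proof. by rewrite gsrcE. Qed.

Lemma gsrc_inv e : gsrc G (ginv G e) = gtgt G e.
Proof. by rewrite gsrcE ginvK. Qed.

Lemma wstep_nil e : wstep [::] e = [:: e].
Proof. by rewrite /wstep /= eq_sym (negbTE (ginv_neq _ _)). Qed.

Lemma wstep_rcons w f e :
  wstep (rcons w f) e = if f == ginv G e then w else rcons (rcons w f) e.
Proof.
by rewrite /wstep last_rcons size_rcons /= -cats1 take_size_cat.
Qed.

Lemma walk_cat u q q' :
  walk u (q ++ q') = walk u q && walk (walk_end G u q) q'.
Proof. by elim: q u => //= e q IH u; rewrite IH andbA. Qed.

Lemma walk_rcons u q e :
  walk u (rcons q e) = walk u q && (gsrc G e == walk_end G u q).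
Proof. by rewrite -cats1 walk_cat /= andbT. Qed.

Lemma walk_end_cat u q q' :
  walk_end G u (q ++ q') = walk_end G (walk_end G u q) q'.
Proof. by rewrite /walk_end map_cat last_cat. Qed.

Lemma walk_end_rcons u q e : walk_end G u (rcons q e) = gtgt G e.
Proof. by rewrite /walk_end map_rcons last_rcons. Qed.

Lemma walk_end_cons u q e : walk_end G u (e :: q) = walk_end G (gtgt G e) q.
Proof. by []. Qed.

Lemma winv_cons e q : winv (e :: q) = rcons (winv q) (ginv G e).
Proof. by rewrite /winv /= rev_cons. Qed.

Lemma winvK : involutive winv.
Proof.
move=> q; rewrite /winv map_rev revK -map_comp map_id_in // => e _.
exact: ginvK.
Qed.

Lemma walk_winv u q : walk u q ->
  walk (walk_end G u q) (winv q) && (walk_end G (walk_end G u q) (winv q) == u).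
Proof.
elim: q u => [|e q IH] u /=; first by rewrite /walk_end /= eqxx.
case/andP=> /eqP su /IH /andP[wq /eqP eq].
by rewrite winv_cons walk_end_cons walk_rcons wq eq gsrc_inv eqxx walk_end_rcons
   gtgt_inv su eqxx.
Qed.

Lemma nb_walk_walk u q : nb_walk G u q -> walk u q.
Proof.
case: q => //= e q /andP[-> /=].
by elim: q e => //= f q IH e /andP[/andP[/eqP -> _] /IH ->]; rewrite eqxx.
Qed.

Lemma nb_walk_rconsE u q f e :
  nb_walk G u (rcons (rcons q f) e)
  = [&& nb_walk G u (rcons q f), gtgt G f == gsrc G e & f != ginv G e].
Proof.
case: q => [|g q] /=; first by rewrite /nb_step !andbT andbA.
by rewrite !rcons_path last_rcons !andbA.
Qed.

Lemma wstep_nb u w e : nb_walk G u w -> gsrc G e = walk_end G u w ->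
  nb_walk G u (wstep w e).
Proof.
case/lastP: w => [|w f] nw se; first by rewrite wstep_nil /= se /walk_end eqxx.
rewrite wstep_rcons; case: ifPn => fe.
  case/lastP: w nw {se} => // w g; rewrite nb_walk_rconsE; by case/andP.
by rewrite nb_walk_rconsE nw se walk_end_rcons eqxx.
Qed.

Lemma wstep_end u w e : nb_walk G u w -> gsrc G e = walk_end G u w ->
  walk_end G u (wstep w e) = gtgt G e.
Proof.
case/lastP: w => [|w f] nw se; first by rewrite wstep_nil.
rewrite wstep_rcons; case: ifPn => [/eqP fe|_]; last by rewrite walk_end_rcons.
have /nb_walk_walk := nw; rewrite walk_rcons => /andP[_ /eqP <-].
by rewrite fe gsrc_inv.
Qed.

Lemma wstepK u w e : nb_walk G u w -> gsrc G e = walk_end G u w ->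
  wstep (wstep w e) (ginv G e) = w.
Proof.
case/lastP: w => [|w f] nw se.
  by rewrite wstep_nil (wstep_rcons [::]) ginvK eqxx.
rewrite wstep_rcons; case: ifPn => [/eqP fe|_]; last by rewrite wstep_rcons ginvK eqxx.
(* Once [e] has cancelled [f], the returning letter [ginv G e = f] must not cancel the preceding
   [g]; this holds because the original word is non-backtracking. *)
case/lastP: w nw {se} => [|w g] nw; first by rewrite wstep_nil fe.
move: nw; rewrite wstep_rcons ginvK nb_walk_rconsE => /and3P[_ _].
by rewrite fe ginvK => /negbTE ->.
Qed.

Lemma wact_cat w q q' : wact w (q ++ q') = wact (wact w q) q'.
Proof. exact: foldl_cat. Qed.

Lemma wact_rcons w q e : wact w (rcons q e) = wstep (wact w q) e.
Proof. exact: foldl_rcons. Qed.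

Lemma wact_nb u w q : nb_walk G u w -> walk (walk_end G u w) q ->
  nb_walk G u (wact w q) /\ walk_end G u (wact w q) = walk_end G (walk_end G u w) q.
Proof.
elim: q w => //= e q IH w nw /andP[/eqP se wq].
have := IH (wstep w e) (wstep_nb nw se).
by rewrite wstep_end // => /(_ wq); rewrite walk_end_cons.
Qed.

Lemma wact_winvK u w q : nb_walk G u w -> walk (walk_end G u w) q ->
  wact (wact w q) (winv q) = w.
Proof.
elim: q w => //= e q IH w nw /andP[/eqP se wq].
rewrite winv_cons wact_rcons IH ?wstep_nb ?wstep_end //.
exact: wstepK nw se.
Qed.

Lemma wact_nil_nb u q : nb_walk G u q -> wact [::] q = q.
Proof.
elim/last_ind: q => // q e IH nq; rewrite wact_rcons IH; last first.
  exact: nb_walk_rcons nq.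
case/lastP: q nq {IH} => [|q f]; first by rewrite wstep_nil.
by rewrite nb_walk_rconsE wstep_rcons => /and3P[_ _ /negbTE ->].
Qed.

Lemma wact_nil_walk u q : walk u q ->
  nb_walk G u (wact [::] q) /\ walk_end G u (wact [::] q) = walk_end G u q.
Proof. by move=> wq; apply: (@wact_nb u [::] q). Qed.

(** The action of a walk depends only on its reduction: a letter dropped by the reduction is
    followed in [q] by its inverse, and [wstepK] says that the two steps undo each other. *)
Lemma wact_reduce u w q : nb_walk G u w -> walk (walk_end G u w) q ->
  wact w (wact [::] q) = wact w q.
Proof.
move=> nw; elim/last_ind: q => // q e IH; rewrite walk_rcons => /andP[wq /eqP se].
rewrite !wact_rcons -(IH wq).
have [ny ey] := wact_nil_walk wq; rewrite -ey in se.
case/lastP: (wact [::] q) ny se {ey IH wq} => [|y f] ny se.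
  by rewrite wstep_nil.
rewrite wstep_rcons; case: ifPn => [/eqP fe|_]; last by rewrite wact_rcons.
have wy := nb_walk_walk (nb_walk_rcons ny); have [n1 e1] := wact_nb nw wy.
have {fe}-> : e = ginv G f by rewrite fe ginvK.
rewrite wact_rcons (wstepK n1) // e1.
by have := nb_walk_walk ny; rewrite walk_rcons => /andP[_ /eqP].
Qed.

Lemma wact_cancel u q : walk u q -> wact [::] (q ++ winv q) = [::].
Proof. by move=> wq; rewrite wact_cat (@wact_winvK u). Qed.

(** Prepending [winv w] to the walk [w ++ q] cancels [w], so [wact w q = w] forces the reduction of
    [q] to be empty, and [q] is already reduced. *)
Lemma wact_free u w q : nb_walk G u w -> nb_walk G (walk_end G u w) q ->
  wact w q = w -> q = [::].
Proof.
move=> nw nq wq.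
have ww := nb_walk_walk nw; have /andP[wi /eqP ei] := walk_winv ww.
have wqq := nb_walk_walk nq.
have h : wact [::] (winv w ++ wact [::] (w ++ q)) = wact [::] (winv w ++ (w ++ q)).
  have [n1 e1] := wact_nil_walk wi.
  by rewrite !(wact_cat _ (winv w)) (wact_reduce n1) // e1 ei walk_cat ww.
have i0 : wact [::] (winv w ++ w) = [::].
  by rewrite -{2}(winvK w) (wact_cancel wi).
move: h; rewrite [in RHS]catA [in RHS]wact_cat i0 (wact_nil_nb nq).
by rewrite [wact _ (w ++ q)]wact_cat (wact_nil_nb nw) wq i0.
Qed.

Lemma acyclic_nb_closed u q : acyclic G -> nb_walk G u q ->
  walk_end G u q = u -> q = [::].
Proof.
move=> aG; case: q => // e q /= /andP[/eqP su pq] eu; case: aG.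
exists e, q; split=> //; rewrite su -[RHS]eu /walk_end /=.
by rewrite last_map.
Qed.

(** The reduction of [q ++ winv q'] is a closed non-backtracking walk, hence empty. Letting [q'] act
    on it then gives [q'], but also [q], because [winv q'] and [q'] cancel. *)
Lemma acyclic_nb_unique u q q' : acyclic G -> nb_walk G u q ->
  nb_walk G u q' -> walk_end G u q = walk_end G u q' -> q = q'.
Proof.
move=> aG nq nq' eqq.
have [wq wq'] := (nb_walk_walk nq, nb_walk_walk nq').
have /andP[wi /eqP ei] := walk_winv wq'.
have wc : walk u (q ++ winv q') by rewrite walk_cat wq eqq.
have [n1 e1] := wact_nil_walk wc.
have r0 := acyclic_nb_closed aG n1 (etrans e1 _).
have {r0}r0 : wact [::] (q ++ winv q') = [::].
  by apply: r0; rewrite walk_end_cat eqq ei.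
have : wact (wact [::] (q ++ winv q')) q' = wact [::] q' by rewrite r0.
rewrite -wact_cat -catA 2!wact_cat (wact_nil_nb nq) (wact_nil_nb nq') -wact_cat.
move <-; rewrite -{2}(winvK q') wact_cat (@wact_winvK u) //.
by rewrite eqq.
Qed.

End Words.

(** * The universal cover as a tree *)

Section CoverTree.
Variables (R : realType) (V E : finType) (G : jgraph R V E) (r : V).
Local Notation T := (cover_vertex G r).
Local Notation tend := (@cover_vmap R V E G r).
Implicit Types (p x y : T) (e f : E) (q : seq E).

(** The default [p] of [insubd] is reached only when [e] does not start at the end of [p]. *)
Definition step p e : T := insubd p (wstep G (val p) e).

Definition act p q : T := foldl step p q.

Lemma val_step p e : gsrc G e = tend p -> val (step p e) = wstep G (val p) e.
Proof. by move=> se; rewrite insubdK //; apply: wstep_nb (valP p) se. Qed.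

Lemma step_end p e : gsrc G e = tend p -> tend (step p e) = gtgt G e.
Proof. by move=> se; rewrite /cover_vmap val_step // (wstep_end (valP p)). Qed.

Lemma stepK p e : gsrc G e = tend p -> step (step p e) (ginv G e) = p.
Proof.
move=> se; apply: val_inj; rewrite val_step ?val_step //.
  exact: wstepK (valP p) se.
by rewrite step_end // gsrc_inv.
Qed.

Lemma step_src p e : gsrc G e = tend p -> gsrc G (ginv G e) = tend (step p e).
Proof. by move=> se; rewrite step_end // gsrc_inv. Qed.

Lemma act_cat p q q' : act p (q ++ q') = act (act p q) q'.
Proof. exact: foldl_cat. Qed.

Lemma act_rcons p q e : act p (rcons q e) = step (act p q) e.
Proof. exact: foldl_rcons. Qed.

Lemma act_spec p q : walk G (tend p) q ->
  val (act p q) = wact G (val p) q /\ tend (act p q) = walk_end G (tend p) q.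
Proof.
elim: q p => //= e q IH p /andP[/eqP se wq].
have := IH (step p e); rewrite step_end // => /(_ wq)[-> ->].
by rewrite val_step.
Qed.

Lemma act_end p q : walk G (tend p) q -> tend (act p q) = walk_end G (tend p) q.
Proof. by case/act_spec. Qed.

Lemma act_winvK p q : walk G (tend p) q -> act (act p q) (winv G q) = p.
Proof.
move=> wq; have /andP[wi /eqP ei] := walk_winv wq.
apply: val_inj; rewrite (act_spec _).1 ?act_end // (act_spec wq).1.
exact: wact_winvK (valP p) wq.
Qed.

Lemma act_free p q : nb_walk G (tend p) q -> act p q = p -> q = [::].
Proof.
move=> nq /(congr1 val); rewrite (act_spec (nb_walk_walk nq)).1.
exact: wact_free (valP p) nq.
Qed.

(** This walk from [p] to [x] passes through the root, so it is in general not reduced; [act]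
    performs the cancellations. *)
Definition path_to p x : seq E := winv G (val p) ++ val x.

Lemma walk_val p : walk G r (val p).
Proof. exact: nb_walk_walk (valP p). Qed.

Lemma walk_path_to p x : walk G (tend p) (path_to p x).
Proof.
have /andP[wi /eqP ei] := walk_winv (walk_val p).
by rewrite walk_cat wi /cover_vmap ei walk_val.
Qed.

Lemma walk_end_path_to p x : walk_end G (tend p) (path_to p x) = tend x.
Proof.
have /andP[wi /eqP ei] := walk_winv (walk_val p).
by rewrite walk_end_cat /cover_vmap ei.
Qed.

Lemma act_path_to p x : act p (path_to p x) = x.
Proof.
apply: val_inj; rewrite (act_spec (walk_path_to p x)).1 wact_cat.
have -> : wact G (val p) (winv G (val p)) = [::].
  by rewrite -{1}(wact_nil_nb (valP p)) (@wact_winvK _ _ _ _ r) ?walk_val.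
exact: wact_nil_nb (valP x).
Qed.

(** Connectedness of the cover, as an induction principle with arbitrary base point. *)
Lemma cover_ind p (P : T -> Prop) : P p ->
  (forall x e, gsrc G e = tend x -> P x -> P (step x e)) -> forall x, P x.
Proof.
move=> Pp PS x; rewrite -(act_path_to p x).
suff H q y : P y -> walk G (tend y) q -> P (act y q) by apply: H => //; exact: walk_path_to.
elim: q y => //= e q IH y Py /andP[/eqP se wq].
by apply: IH; [exact: PS|rewrite step_end].
Qed.

Lemma cover_lift (connG : gconnected G) v : exists p, tend p = v.
Proof.
have r0 : nb_walk G r [::] by [].
suff H a b : connect (Defs.adjacent G) a b -> (exists p, tend p = a) ->
    exists p, tend p = b.
  by apply: H (connG r v) _; exists (exist (nb_walk G r) [::] r0).
case/connectP => s + ->; elim: s a => //= c s IH a.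
case/andP => /existsP[e /andP[/eqP sa /eqP tc]] ps [p pa].
by apply: IH ps _; exists (step p e); rewrite step_end ?sa.
Qed.

(** For [p] and [p'] over the same vertex this is the deck transformation taking [p] to [p']: the
    walk from [p] to [x] is replayed from [p']. *)
Definition deck p p' x : T := act p' (path_to p x).

Section Deck.
Variables p p' : T.
Hypothesis ends : tend p = tend p'.

Lemma deck_end x : tend (deck p p' x) = tend x.
Proof. by rewrite act_end -ends ?walk_path_to // walk_end_path_to. Qed.

(** Replacing [x] by [step x e] either appends [e] to [path_to p x] or deletes its last letter; in
    the second case [stepK] identifies the deletion with a step along [e]. *)
Lemma deck_step x e : gsrc G e = tend x ->
  deck p p' (step x e) = step (deck p p' x) e.
Proof.
move=> se; rewrite /deck /path_to val_step //.
case/lastP Ew: (val x) => [|w f]; first by rewrite wstep_nil cats0 cats1 act_rcons.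
rewrite wstep_rcons; case: ifPn => [/eqP fe|_].
  rewrite -rcons_cat act_rcons (_ : e = ginv G f); last by rewrite fe ginvK.
  have := walk_path_to p x; rewrite /path_to Ew -rcons_cat walk_rcons ends.
  by case/andP=> wq /eqP sf; rewrite stepK // act_end.
by rewrite -!rcons_cat !act_rcons.
Qed.

Lemma deck_base : deck p p' p = p'.
Proof.
rewrite /deck act_cat -{2}(winvK G (val p)) act_winvK // -ends.
by have /andP[] := walk_winv (walk_val p).
Qed.

End Deck.

Lemma deckK p p' : tend p = tend p' -> cancel (deck p p') (deck p' p).
Proof.
move=> ends x; elim/(@cover_ind p): x; first by rewrite !deck_base.
by move=> x e se IH; rewrite !deck_step ?deck_end // IH.
Qed.

Lemma deck_bij p p' : tend p = tend p' -> bijective (deck p p').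
Proof. by move=> ends; exists (deck p' p); apply: deckK. Qed.

(* The component containing [step p e] of the tree from which the edge joining
   [p] and [step p e] has been removed. *)
Definition branch p e x : bool :=
  if last e (val p) == ginv G e then ~~ prefix (val p) (val x)
  else prefix (rcons (val p) e) (val x).

Lemma prefix_rconsE (q w : seq E) f :
  prefix q (rcons w f) = prefix q w || (q == rcons w f).
Proof.
apply/idP/orP => [/prefixP[s]|[/prefixP[s ->]|/eqP->]].
- case/lastP: s => [|s g]; first by rewrite cats0 => ->; right.
  by rewrite -rcons_cat => /rcons_inj[-> _]; left; exact: prefix_prefix.
- by rewrite rcons_cat prefix_prefix.
- exact: prefix_refl.
Qed.

Lemma nprefix_rcons (w : seq E) f : prefix (rcons w f) w = false.
Proof. by apply/negbTE/negP => /size_prefix; rewrite size_rcons ltnn. Qed.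

Lemma last_ginvP (w : seq E) e : last e w == ginv G e ->
  w = rcons (take (size w).-1 w) (ginv G e).
Proof.
case/lastP: w => [|w f] /=; first by rewrite eq_sym (negbTE (ginv_neq _ _)).
by rewrite last_rcons size_rcons /= -[in take _ _]cats1 take_size_cat // => /eqP ->.
Qed.

Lemma branch_base p e : branch p e p = false.
Proof. by rewrite /branch prefix_refl nprefix_rcons; case: ifP. Qed.

Lemma branch_step p e : gsrc G e = tend p -> branch p e (step p e).
Proof.
move=> se; rewrite /branch val_step //.
case: ifP => L; rewrite /wstep L; last exact: prefix_refl.
by have := last_ginvP L; move: (take _ _) => w ->; rewrite nprefix_rcons.
Qed.

Lemma branch_stepE p e x f : gsrc G e = tend p -> gsrc G f = tend x ->
  (x, f) != (p, e) -> (x, f) != (step p e, ginv G e) ->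
  branch p e (step x f) = branch p e x.
Proof.
move=> se sf n1 n2.
(* The words with prefix [q] form a subtree, entered or left only across the edge between [q] and
   its parent; the last two alternatives are these two crossings. *)
have H (q : seq E) : prefix q (wstep G (val x) f) = prefix q (val x) \/
    q = rcons (val x) f \/ q = val x /\ last f (val x) = ginv G f.
  rewrite /wstep; case: ifP => [/eqP L|_].
    have := last_ginvP (introT eqP L); move: (take _ _) => w xw.
    rewrite [in RHS]xw prefix_rconsE; case: eqP => [qw|]; last by left; rewrite orbF.
    by right; right; rewrite qw -xw.
  by rewrite prefix_rconsE; case: eqP => [qw|]; [right; left|left; rewrite orbF].
rewrite /branch val_step //; case: ifP => L.
  case: (H (val p)) => [->//|[px|[px lx]]].
    have := last_ginvP L; rewrite {1}px => /rcons_inj[xp fe].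
    case/eqP: n2; congr pair => //; apply: val_inj.
    by rewrite val_step // /wstep L.
  have xp : x = p by exact: val_inj.
  case/eqP: n1; rewrite xp; congr pair; move: lx; rewrite xp.
  have -> : last f (val p) = last e (val p) by rewrite (last_ginvP L) !last_rcons.
  by rewrite (eqP L) => /(can_inj (ginvK G)).
case: (H (rcons (val p) e)) => [->//|[/rcons_inj[px ef]|[px lx]]].
  by case/eqP: n1; congr pair => //; exact: val_inj.
case/eqP: n2; congr pair.
  by apply: val_inj; rewrite val_step // /wstep L.
by move: lx; rewrite -px last_rcons => ->; rewrite ginvK.
Qed.

(** Since the tree is connected, a set is known once the edges crossing its border are. Branches can
    thus be identified without computing with prefixes. *)
Lemma branch_unique p e (B : T -> bool) : gsrc G e = tend p -> ~~ B p ->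
  B (step p e) ->
  (forall x f, gsrc G f = tend x -> (x, f) != (p, e) ->
    (x, f) != (step p e, ginv G e) -> B (step x f) = B x) ->
  B =1 branch p e.
Proof.
move=> se Bp Bs BS x; elim/(@cover_ind p): x; first by rewrite branch_base (negbTE Bp).
move=> x f sf Bx; have [[-> ->]|n1] := eqVneq (x, f) (p, e).
  by rewrite branch_step.
have [[-> ->]|n2] := eqVneq (x, f) (step p e, ginv G e).
  by rewrite stepK // branch_base (negbTE Bp).
by rewrite BS // branch_stepE.
Qed.

Lemma branch_compl p e x : gsrc G e = tend p ->
  branch (step p e) (ginv G e) x = ~~ branch p e x.
Proof.
move=> se; have si := step_src se; rewrite -[LHS]negbK; congr negb; move: x.
apply: branch_unique => // [||x f sf n1 n2].
- by rewrite -{2}[p](stepK se) branch_step.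
- by rewrite branch_base.
- by rewrite branch_stepE // ?stepK ?ginvK.
Qed.

Lemma branch_deck p p' e x : tend p = tend p' -> gsrc G e = tend p ->
  branch p' e (deck p p' x) = branch p e x.
Proof.
move=> ends se; have se' : gsrc G e = tend p' by rewrite -ends.
move: x; apply: branch_unique => // [||x f sf n1 n2].
- by rewrite deck_base // branch_base.
- by rewrite deck_step // deck_base // branch_step.
- have inj := bij_inj (deck_bij ends).
  rewrite deck_step // branch_stepE ?deck_end //.
    by apply: contraNneq n1 => -[+ ->]; rewrite -[X in _ = X](deck_base ends) => /inj ->.
  apply: contraNneq n2 => -[+ ->]; rewrite -[X in step X](deck_base ends) -deck_step //.
  by move=> /inj ->.
Qed.

Lemma nb_walk_prefix u (q q' : seq E) : nb_walk G u (q ++ q') -> nb_walk G u q.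
Proof.
elim/last_ind: q' => [|q' e IH]; first by rewrite cats0.
by rewrite -rcons_cat => /nb_walk_rcons.
Qed.

(** The edge is the first one on the way from [p] to [x]: the next letter of [x] if [p] is a prefix
    of it, and otherwise the edge from [p] back towards the root. *)
Lemma branch_ex p x : x != p -> exists2 e, gsrc G e = tend p & branch p e x.
Proof.
move=> xp; case: (boolP (prefix (val p) (val x))) => [/prefixP[s xs]|px].
  case: s xs => [|e s] xs.
    by case/eqP: xp; apply: val_inj; rewrite xs cats0.
  have nx : nb_walk G r (rcons (val p) e).
    by apply: (@nb_walk_prefix _ _ s); rewrite cat_rcons -xs (valP x).
  exists e; first by have := nb_walk_walk nx; rewrite walk_rcons => /andP[_ /eqP].
  rewrite /branch xs -cat_rcons prefix_prefix ifN //.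
  case/lastP: (val p) nx => [|w g]; first by rewrite eq_sym ginv_neq.
  by rewrite nb_walk_rconsE last_rcons => /and3P[].
case/lastP Ew: (val p) px => [|w g] px; first by rewrite prefix0s in px.
exists (ginv G g); first by rewrite gsrc_inv /cover_vmap Ew walk_end_rcons.
by rewrite /branch Ew last_rcons ginvK eqxx.
Qed.

Lemma branch_uniq p e f x : branch p e x -> branch p f x -> e = f.
Proof.
rewrite /branch; case: ifP => [/last_ginvP Le|_]; case: ifP => [/last_ginvP Lf|_].
- move=> _ _; apply: (can_inj (ginvK G)).
  by have /(congr1 (last e)) := Le; rewrite {1}Lf !last_rcons.
- by move=> + /prefixP[s xs]; rewrite xs cat_rcons prefix_prefix.
- by move=> /prefixP[s xs]; rewrite xs cat_rcons prefix_prefix.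
- move=> /prefixP[s ->] /prefixP[s'] /eqP; rewrite !cat_rcons eqseq_cat //.
  by case/andP=> _ /eqP[].
Qed.

Lemma fsbig_fin (I : finType) (P : pred I) (A : set I) (F : I -> R[i]) :
  (forall i, A i <-> P i) -> \sum_(i \in A) F i = \sum_(i | P i) F i.
Proof.
move=> AP; have -> : A = [set` enum P].
  by apply/seteqP; split=> i /=; rewrite mem_enum => /AP.
by rewrite -fsbig_seq ?enum_uniq // big_enum.
Qed.

(** The cover edges ending at [p] are reindexed by the edges of [G] leaving [tend p]. Such an edge
    points away from [p], so its weight enters reversed. *)
Lemma jacobi_cover z p : jacobi (universal_cover G r) z p =
  (gpot G (tend p))%:C * z p
  + \sum_(e | gsrc G e == tend p) gwt G (ginv G e) * z (step p e).
Proof.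
congr (_ + _).
pose h (x : cover_edge G r) := ginv G (cover_emap x).
pose Q := [set e | gsrc G e = tend p].
have hsrc (x : cover_edge G r) : cover_tgt x = p ->
    gsrc G (h x) = tend p /\ step p (h x) = cover_src x.
  case: x => -[[w e] /= nw] [] /= <-; rewrite /h /cover_emap /=.
    have se : gsrc G (ginv G e) = tend (exist (nb_walk G r) (rcons w e) nw).
      by rewrite /cover_vmap /= walk_end_rcons gsrc_inv.
    split=> //; apply: val_inj; rewrite val_step //= wstep_rcons ginvK eqxx //.
  rewrite ginvK; have := nb_walk_walk nw; rewrite walk_rcons => /andP[_ /eqP se].
  split=> //; apply: val_inj; rewrite val_step //= /wstep ifN //.
  case/lastP: {se} w nw => [|w g]; first by rewrite eq_sym ginv_neq.
  by rewrite last_rcons /= nb_walk_rconsE => /and3P[].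
rewrite -(@fsbig_fin _ _ Q) => [|e]; last by split=> /eqP.
rewrite (reindex_fsbig h [set x | cover_tgt x = p]).
  apply: eq_fsbigr => x; rewrite inE /= => /hsrc[_ ->].
  by rewrite /h ginvK.
split=> [x /hsrc[]//|x y|e /= se].
  rewrite !inE /= => xp yp hxy.
  have [[sx ex] [sy ey]] := (hsrc _ xp, hsrc _ yp).
  have {ex ey}exy : cover_src x = cover_src y by rewrite -ex -ey hxy.
  have {}xyp : cover_tgt x = cover_tgt y by rewrite xp yp.
  have szn (w : seq E) g : w <> rcons w g.
    by move/(congr1 size)/eqP; rewrite size_rcons ltn_eqF.
  case: x y xp yp hxy sx sy exy xyp => -[[w e] nw] b [[[w' e'] nw'] b'] /= _ _ + _ _.
  rewrite /h /cover_emap /cover_src /cover_tgt.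
  (* If the two edges had opposite orientations, one would lengthen and the other shorten the same
     word. *)
  case: b; case: b' => /= hxy /(congr1 val) /= e1 /(congr1 val) /= e2.
  - by congr pair; apply: val_inj; rewrite /= e1 -(can_inj (ginvK G) hxy).
  - by have := congr1 size e1; have := congr1 size e2; rewrite !size_rcons; lia.
  - by have := congr1 size e1; have := congr1 size e2; rewrite !size_rcons; lia.
  - by congr pair; apply: val_inj; rewrite /=; case/rcons_inj: e1 => -> ->.
(* For surjectivity, the preimage of [e] comes from the parent of [p] when [e] cancels the last
   letter of [p], and from the child [p e] otherwise. *)
case: (boolP (last e (val p) == ginv G e)) => L.
  have nw : nb_walk G r (rcons (take (size (val p)).-1 (val p)) (ginv G e)).
    by rewrite -(last_ginvP L) (valP p).
  exists (exist _ (take (size (val p)).-1 (val p), ginv G e) nw, true).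
    by apply: val_inj; rewrite /= -(last_ginvP L).
  by rewrite /h /cover_emap /= ginvK.
have nw : nb_walk G r (rcons (val p) e).
  by have := valP (step p e); rewrite val_step // /wstep (negbTE L).
exists (exist _ (val p, e) nw, false); last by rewrite /h /cover_emap /= ginvK.
exact: val_inj.
Qed.

End CoverTree.

(** * Boundedness of the Jacobi operator *)

Section Boundedness.
Variables (R : realType) (V E : finType) (G : jgraph R V E) (r : V).
Local Notation T := (cover_vertex G r).
Local Notation tend := (@cover_vmap R V E G r).
Local Notation A := (jacobi (universal_cover G r)).
Implicit Types (p x y : T) (e f : E) (z : T -> R[i]).

Lemma sqmod_sum_le (I : Type) (s : seq I) (P : pred I) (F : I -> R[i]) :
  sqmod (\sum_(i <- s | P i) F i)
    <= 2 ^+ size s * \sum_(i <- s | P i) sqmod (F i).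
Proof.
elim: s => [|i s IH] /=.
  by rewrite !big_nil mulr0 /sqmod /= expr0n /= addr0.
rewrite !big_cons exprS; have h : 1 <= 2 ^+ size s :> R by rewrite exprn_ege1 // ler1n.
have S0 : 0 <= \sum_(j <- s | P j) sqmod (F j) by apply: sumr_ge0 => j _; exact: sqmod_ge0.
have F0 := sqmod_ge0 (F i).
case: ifP => _; last by nra.
apply: le_trans (sqmodD_le _ _) _; nra.
Qed.

Lemma nnsum_sum (I : Type) (s : seq I) (F : I -> T -> R) (S : set T) :
  (forall i v, 0 <= F i v) ->
  nnsum S (fun v => \sum_(i <- s) F i v) = (\sum_(i <- s) nnsum S (F i))%E.
Proof.
move=> F0; elim: s => [|i s IH].
  rewrite big_nil /nnsum esum1 // => v _; by rewrite big_nil.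
rewrite big_cons -IH -nnsumD // => [|v]; last exact: sumr_ge0.
by congr nnsum; apply/funext => v; rewrite big_cons.
Qed.

Lemma nnsum_mkcond (S : set T) (F : T -> R) :
  nnsum S F = nnsum setT (fun v => if `[< S v >] then F v else 0).
Proof.
rewrite /nnsum esum_mkcond; apply: eq_esum => v _.
by case: asboolP => Sv; rewrite ?(mem_set Sv) ?(memNset Sv).
Qed.

Lemma nnsum_inj_le (S : set T) (f : T -> T) (F : T -> R) :
  (forall v, 0 <= F v) -> (forall v w, S v -> S w -> f v = f w -> v = w) ->
  (nnsum S (F \o f) <= nnsum setT F)%E.
Proof.
move=> F0 fI; rewrite {1}/nnsum -(reindex_esum S (f @` S) f (fun v => (F v)%:E)).
  rewrite -/(nnsum _ F) nnsum_mkcond; apply: nnsum_le => v.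
  by case: ifP.
split=> [v Sv|v w|v [w Sw <-]]; [by exists v| |by exists w].
by rewrite !inE; exact: fI.
Qed.

Definition shifted z e p : R :=
  if `[< gsrc G e = tend p >] then sqmod (z (step p e)) else 0.

Lemma shifted_ge0 z e p : 0 <= shifted z e p.
Proof. by rewrite /shifted; case: ifP => // _; exact: sqmod_ge0. Qed.

(** By [stepK], stepping along a fixed edge is injective where it is defined, so the shifted family
    rearranges part of the original one. *)
Lemma nnsum_shifted z e :
  (nnsum setT (shifted z e) <= nnsum setT (@sqmod R \o z))%E.
Proof.
have -> : nnsum setT (shifted z e)
    = nnsum [set p | gsrc G e = tend p] ((@sqmod R \o z) \o (step (r := r))^~ e).
  by rewrite [RHS]nnsum_mkcond.
apply: nnsum_inj_le => [p|p q /= sp sq spq].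
  exact: sqmod_ge0.
by rewrite -(stepK sp) spq stepK.
Qed.

Definition jbound : R :=
  \sum_(u : V) sqmod (gpot G u)%:C + \sum_(e : E) sqmod (gwt G e).

Lemma jbound_ge0 : 0 <= jbound.
Proof. by rewrite addr_ge0 // sumr_ge0 // => i _; exact: sqmod_ge0. Qed.

Lemma gpot_le u : sqmod (gpot G u)%:C <= jbound.
Proof.
apply: (@le_trans _ _ (\sum_(u : V) sqmod (gpot G u)%:C)); last first.
  by rewrite lerDl sumr_ge0 // => i _; exact: sqmod_ge0.
by rewrite (bigD1 u) //= lerDl sumr_ge0 // => i _; exact: sqmod_ge0.
Qed.

Lemma gwt_le e : sqmod (gwt G e) <= jbound.
Proof.
apply: (@le_trans _ _ (\sum_(e : E) sqmod (gwt G e))); last first.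
  by rewrite lerDr sumr_ge0 // => i _; exact: sqmod_ge0.
by rewrite (bigD1 e) //= lerDl sumr_ge0 // => i _; exact: sqmod_ge0.
Qed.

(** The factor 2 separates the potential from the edge terms, and the power of 2 is the cost of
    splitting the sum over edges by [sqmod_sum_le]. *)
Definition jconst : R := 2 * 2 ^+ size (index_enum E) * jbound.

Lemma jconst_ge0 : 0 <= jconst.
Proof. by rewrite !mulr_ge0 ?exprn_ge0 ?jbound_ge0. Qed.

Lemma jacobi_sqmod_le z p : sqmod (A z p) <=
  jconst * (sqmod (z p) + \sum_(e : E) shifted z e p).
Proof.
rewrite jacobi_cover; apply: le_trans (sqmodD_le _ _) _.
rewrite /jconst -!mulrA ler_wpM2l // !mulrA mulrDr lerD //.
  rewrite sqmodM; apply: ler_wpM2r; first exact: sqmod_ge0.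
  apply: le_trans (gpot_le _) _; rewrite ler_peMl ?jbound_ge0 //.
  by rewrite exprn_ege1 // ler1n.
apply: le_trans (sqmod_sum_le _ _ _) _; rewrite -mulrA ler_wpM2l ?exprn_ge0 //.
rewrite mulr_sumr big_mkcond /=; apply: ler_sum => e _.
rewrite sqmodM /shifted; case: eqP => se.
  rewrite asboolT // ler_wpM2r ?sqmod_ge0 //; exact: gwt_le.
by rewrite asboolF // mulr0.
Qed.

Lemma jacobi_nnsum_le z : (nnsum setT (@sqmod R \o A z)
  <= (jconst * (1 + #|E|%:R))%:E * nnsum setT (@sqmod R \o z))%E.
Proof.
set N := nnsum setT (_ \o z).
apply: (@le_trans _ _ (nnsum setT
  (fun p => jconst * (sqmod (z p) + \sum_(e : E) shifted z e p)))).
  by apply: nnsum_le => p; exact: jacobi_sqmod_le.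
have S0 p : 0 <= \sum_(e : E) shifted z e p by apply: sumr_ge0 => e _; exact: shifted_ge0.
have Z0 p : 0 <= sqmod (z p) by exact: sqmod_ge0.
rewrite nnsumZ ?jconst_ge0 // => [|p]; last by rewrite addr_ge0.
rewrite (EFinM jconst) -muleA; apply: lee_wpmul2l; first by rewrite lee_fin jconst_ge0.
rewrite nnsumD // nnsum_sum => [|e p]; last exact: shifted_ge0.
rewrite (EFinD 1) ge0_muleDl ?lee_fin // mul1e; apply: leeD2l.
apply: (@le_trans _ _ (\sum_(e : E) N)%E).
  by apply: lee_sum => e _; exact: nnsum_shifted.
rewrite big_const; elim: #|E| => [|n IH] /=; first by rewrite mul0e.
rewrite -natr1 EFinD ge0_muleDl ?lee_fin // mul1e addeC.
exact: leeD2r.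
Qed.

Lemma jacobi_bounded : exists2 M : R, 0 <= M &
  forall z, l2 z -> l2 (A z) /\ l2norm (A z) <= M * l2norm z.
Proof.
have c0 : 0 <= jconst * (1 + #|E|%:R) by rewrite mulr_ge0 ?jconst_ge0 ?addr_ge0.
exists (Num.sqrt (jconst * (1 + #|E|%:R))); first exact: sqrtr_ge0.
move=> z /l2E lz; have := jacobi_nnsum_le z.
have z0 p : 0 <= (@sqmod R \o z) p by exact: sqmod_ge0.
have Az0 p : 0 <= (@sqmod R \o A z) p by exact: sqmod_ge0.
have zf := nnsum_fin z0 lz; rewrite -(fineK zf) -EFinM => h.
have lA : (nnsum setT (@sqmod R \o A z) < +oo)%E.
  by apply: le_lt_trans h _; exact: ltry.
split; first exact/l2E.
rewrite /l2norm -sqrtrM // ler_wsqrtr //.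
by rewrite -lee_fin fineK // (nnsum_fin Az0 lA).
Qed.

End Boundedness.

(** * The spectral projection at lam *)

Section SpectralProjection.
Variables (R : realType) (V E : finType) (G : jgraph R V E) (r : V).
Local Notation T := (cover_vertex G r).
Local Notation tend := (@cover_vmap R V E G r).
Local Notation A := (jacobi (universal_cover G r)).
Implicit Types (p v w : T) (x y z : T -> R[i]) (f g : R -> R).

Variable Phi : (R -> R) -> (T -> R[i]) -> T -> R[i].
Hypothesis calcPhi : borel_calculus A Phi.
Variable lam : R.

Definition in_kernel z := l2 z /\ forall v, A z v = lam%:C * z v.

Definition ind t : R := (t == lam)%:R.

Lemma bounded_borel_ind : bounded_borel ind.
Proof.
split; last by exists 1 => t; rewrite /ind; case: eqP => _; rewrite ?normr1 ?normr0.
rewrite (_ : ind = \1_[set lam]); first exact: measurable_realfun.measurable_indic.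
by apply/funext => t; rewrite /ind indicE; congr (_%:R); rewrite classical_sets.in_set1.
Qed.

Lemma bounded_borelM f g : bounded_borel f -> bounded_borel g ->
  bounded_borel (fun t => f t * g t).
Proof.
case=> mf [M fM] [mg [N gN]]; split; first exact: measurable_realfun.measurable_funM.
exists (M * N) => t; rewrite normrM ler_pM //.
Qed.

Lemma bounded_borel_cst (c : R) : bounded_borel (fun=> c).
Proof. by split; [exact: measurable_cst|exists `|c|]. Qed.

Lemma bounded_borelD f g : bounded_borel f -> bounded_borel g ->
  bounded_borel (fun t => f t + g t).
Proof.
case=> mf [M fM] [mg [N gN]]; split; first exact: measurable_realfun.measurable_funD.
exists (M + N) => t; apply: le_trans (ler_normD _ _) _; exact: lerD.
Qed.

(** A bounded Borel stand-in for the identity function: by [bc_id] it represents [A] in the calculus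
    once [M] bounds the norm of [A]. *)
Definition clamp (M t : R) : R := Num.max (- M) (Num.min M t).

Lemma bounded_borel_clamp M : 0 <= M -> bounded_borel (clamp M).
Proof.
move=> M0; split.
  apply: measurable_realfun.measurable_maxr; first exact: measurable_cst.
  by apply: measurable_realfun.measurable_minr; [exact: measurable_cst|exact: measurable_id].
exists M => t; rewrite /clamp ler_norml le_max lexx /= ge_max ge_min lexx /= andbT.
lra.
Qed.

Lemma clamp_id M t : - M <= t <= M -> clamp M t = t.
Proof. by case/andP=> h1 h2; rewrite /clamp min_r // max_r. Qed.

Lemma clamp_eq M t : - M < lam < M -> (clamp M t == lam) = (t == lam).
Proof.
case/andP=> h1 h2; rewrite /clamp; case: (leP M t) => h3; case: leP => h4;
  apply/eqP/eqP => h; lra.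
Qed.

Definition proj x : T -> R[i] := Phi ind x.

Lemma calc_ext f g x : f =1 g -> Phi f x = Phi g x.
Proof. by move/funext=> ->. Qed.

Lemma calc_clamp : exists2 M : R, - M < lam < M &
  0 <= M /\ forall z, l2 z -> A z = Phi (clamp M) z.
Proof.
have [M0 M00 MA] := jacobi_bounded G r.
have l0 := normr_ge0 lam.
(* The extra 1 puts [lam] strictly inside the interval, so that [clamp M] takes the value [lam] only
   at [lam]. *)
pose M := M0 + `|lam| + 1.
have M1 : 0 <= M by rewrite /M; lra.
exists M.
  by have := ler_norm lam; have := ler_norm (- lam); rewrite normrN /M; lra.
split=> // z lz; apply/funext => v.
have := @bc_id _ _ _ _ calcPhi (clamp M) M z (bounded_borel_clamp M1).
move=> H; rewrite H // => [y /MA[ly yM]|t]; last exact: clamp_id.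
split=> //; apply: le_trans yM _; rewrite ler_wpM2r ?sqrtr_ge0 // /M; lra.
Qed.

Lemma jacobi_sym x y : l2 x -> l2 y -> inner (A x) y = inner x (A y).
Proof.
move=> lx ly; have [M _ [M0 AM]] := calc_clamp; rewrite !AM //.
exact: (bc_selfadjoint calcPhi (bounded_borel_clamp M0)).
Qed.

Lemma proj_kernel x : l2 x -> in_kernel (proj x).
Proof.
move=> lx; have bi := bounded_borel_ind.
have lP : l2 (proj x) by exact: (bc_l2 calcPhi bi lx).
split=> // v; have [M lM [M0 AM]] := calc_clamp; rewrite AM //.
have bc := bounded_borel_clamp M0.
rewrite /proj -(bc_mul calcPhi bc bi lx).
(* The product of [clamp M] and [ind] is [lam * ind], written here in the shape [c * f + g] of
   [bc_lin]. *)
rewrite (@calc_ext _ (fun t => (lam - 1) * ind t + ind t)) => [|t].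
  rewrite (bc_lin calcPhi _ bi bi lx) rmorphB rmorph1; ring.
rewrite /ind; case: eqP => [->|_]; last by rewrite !mulr0 addr0.
rewrite clamp_id; last by case/andP: lM => *; rewrite !ltW.
ring.
Qed.

(* With y = clamp M - lam, each power of k = 1 - y^2 / (2 M)^2 fixes the kernel
   functions, and these powers converge boundedly to the indicator of lam. *)
Lemma proj_id z : in_kernel z -> forall v, proj z v = z v.
Proof.
case=> lz Az v; have [M lM [M0 AM]] := calc_clamp.
have bc := bounded_borel_clamp M0; have bi := bounded_borel_ind.
pose K := (2 * M) ^+ 2; pose k t := - K^-1 * ((clamp M t - lam) * (clamp M t - lam)) + 1.
have M1 : 0 < M by case/andP: lM => *; lra.
have K0 : 0 < K by rewrite exprn_gt0 // mulr_gt0.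
have by_ : bounded_borel (fun t => clamp M t - lam).
  exact: (bounded_borelD bc (bounded_borel_cst (- lam))).
have byy := bounded_borelM by_ by_.
have b1 := bounded_borel_cst 1.
have bk : bounded_borel k.
  exact: (bounded_borelD (bounded_borelM (bounded_borel_cst (- K^-1)) byy) b1).
have Py w : Phi (fun t => clamp M t - lam) z w = 0.
  rewrite (@calc_ext _ (fun t => (- lam) * 1 + clamp M t)) => [|t]; last by ring.
  rewrite (bc_lin calcPhi _ b1 bc lz) (bc_one calcPhi lz) -AM // Az.
  by rewrite rmorphN; ring.
have Phi0 f w : bounded_borel f -> Phi f (fun=> 0) w = 0.
  move=> bf; have l0 : l2 (fun _ : T => 0 : R[i]).
    by apply: (l2_sqmod lz) => u; rewrite {1}/sqmod /= expr0n /= addr0 sqmod_ge0.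
  have := bc_linear calcPhi (-1) bf l0 l0 w.
  rewrite (_ : (fun _ => -1 * 0 + 0) = fun=> 0); last by apply/funext => u; ring.
  by move->; ring.
have Pyy w : Phi (fun t => (clamp M t - lam) * (clamp M t - lam)) z w = 0.
  rewrite (bc_mul calcPhi by_ by_ lz) (_ : Phi _ z = fun=> 0) ?Phi0 //.
  exact/funext.
have Pk w : Phi k z w = z w.
  by rewrite (bc_lin calcPhi _ byy b1 lz) Pyy (bc_one calcPhi lz); ring.
have bkn n : bounded_borel (fun t => k t ^+ n).
  elim: n => [|n IH]; first exact: b1.
  rewrite (_ : (fun t => _) = (fun t => k t * k t ^+ n)).
    exact: bounded_borelM.
  by apply/funext => t; rewrite exprS.
have Pkn n : Phi (fun t => k t ^+ n) z = z.
  apply/funext => w; elim: n w => [|n IH] w; first exact: (bc_one calcPhi lz).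
  rewrite (@calc_ext _ (fun t => k t * k t ^+ n)) => [|t]; last by rewrite exprS.
  by rewrite (bc_mul calcPhi bk (bkn n) lz) (_ : Phi _ z = z) ?Pk //; exact/funext.
have cl t : - M <= clamp M t <= M.
  by rewrite /clamp le_max lexx /= ge_max ge_min lexx /= andbT; lra.
(* Both [clamp M t] and [lam] lie between [- M] and [M], so their difference is at most [2 * M] in
   absolute value. *)
have k01 t : 0 <= k t <= 1.
  have /andP[c1 c2] := cl t; have /andP[d1 d2] := lM.
  rewrite /k mulNr addrC subr_ge0 gerBl mulr_ge0 ?invr_ge0 ?(ltW K0) -?expr2 ?sqr_ge0 // andbT.
  rewrite ler_pdivrMl // mulr1 /K -subr_ge0.
  rewrite (_ : _ - _ = (2 * M - (clamp M t - lam)) * (2 * M + (clamp M t - lam))); last by ring.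
  by rewrite mulr_ge0 //; lra.
have kcvg t : (fun n => k t ^+ n) @ \oo --> ind t.
  rewrite /ind; have [tl|tl] := eqVneq t lam.
    have -> : k t = 1.
      by rewrite /k tl clamp_id ?subrr ?mulr0 ?add0r //; case/andP: lM => *; rewrite !ltW.
    under eq_fun do rewrite expr1n; exact: cvg_cst.
  apply: cvg_expr; have /andP[k0 k1] := k01 t; rewrite ger0_norm // lt_neqAle k1 andbT.
  have K1 : - K^-1 != 0 by rewrite oppr_eq0 invr_eq0 gt_eqF.
  have y0 : clamp M t - lam != 0 by rewrite subr_eq0 clamp_eq.
  by rewrite /k -subr_eq0 addrK !mulf_neq0.
have k1 n t : `|k t ^+ n| <= 1.
  by have /andP[k0 k1] := k01 t; rewrite normrX ger0_norm // exprn_ile1.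
have h := @bc_cvg _ _ _ _ calcPhi (fun n t => k t ^+ n) ind 1 z bkn bi k1 kcvg lz.
(* As all powers of [k] fix [z], the convergent sequence of norms is constant, so its limit 0 is its
   value. *)
have {}h : (fun n : nat => l2norm (fun v => z v - proj z v)) @ \oo --> (0 : R).
  apply: cvg_trans h; apply: near_eq_cvg; apply: nearW => n.
  by rewrite Pkn.
have n0 : l2norm (fun v => z v - proj z v) = 0.
  by apply: (cvg_unique _ (cvg_cst _) h).
apply/esym/eqP; rewrite -subr_eq0; apply/eqP.
apply: (l2norm_eq0 _ n0 v).
have lP : l2 (proj z) by exact: (bc_l2 calcPhi bi lz).
rewrite (_ : (fun v => _) = fun v => z v + (-1) * proj z v); last by apply/funext => w; ring.
by apply: l2D => //; exact: l2Z.
Qed.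

(** The reproducing function [xi_w] of the kernel of [lam - A]. *)
Definition repr_kernel w : T -> R[i] := proj (Defs.delta R w).

Lemma repr_kernel_in w : in_kernel (repr_kernel w).
Proof. by apply: proj_kernel; exact: l2_delta. Qed.

Lemma inner_repr_proj w x : l2 x -> inner (repr_kernel w) x = proj x w.
Proof.
move=> lx; rewrite /repr_kernel /proj.
rewrite (bc_selfadjoint calcPhi bounded_borel_ind (l2_delta R w) lx).
by rewrite inner_conj inner_delta conjCK.
Qed.

Lemma inner_repr w z : in_kernel z -> inner (repr_kernel w) z = z w.
Proof. by move=> kz; rewrite inner_repr_proj ?proj_id //; case: kz. Qed.

Variable mu : V -> {measure set R -> \bar R}.
Hypothesis mu_spec : forall (u : V) p, tend p = u -> spectral_measure Phi p (mu u).

Definition atom (u : V) : R := fine (mu u [set lam]%classic).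

Lemma mu_atom p : mu (tend p) [set lam]%classic = (atom (tend p))%:E
  /\ repr_kernel p p = (atom (tend p))%:C.
Proof.
have innerd x : inner (Defs.delta R p) x = x p.
  by rewrite inner_conj inner_delta conjCK.
have m1 := mu_spec (erefl (tend p)) (bounded_borel_cst 1).
have fT : (mu (tend p) setT < +oo)%E.
  (* With infinite mass the real integral of 1 would be 0, the value of [fine] at infinity, whereas
     the spectral identity makes it 1. *)
  rewrite ltey; apply/eqP => mT; move: m1.
  rewrite innerd (bc_one calcPhi (l2_delta R p)) /Defs.delta eqxx Rintegral_cst // mT /=.
  by move/eqP; rewrite mulr0 eq_complex /= oner_eq0.
have fl : (mu (tend p) [set lam] < +oo)%E.
  by apply: le_lt_trans fT; apply: le_measure; rewrite ?inE.
have me : mu (tend p) [set lam]%classic = (atom (tend p))%:E.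
  by rewrite /atom fineK // ge0_fin_numE.
split=> //; have := mu_spec (erefl (tend p)) bounded_borel_ind.
rewrite innerd /repr_kernel /proj => ->; congr (_%:C); rewrite /Rintegral /atom; congr fine.
rewrite -[in RHS](setIT [set lam]) -integral_indic //.
by apply: eq_integral => t _; rewrite /ind indicE classical_sets.in_set1.
Qed.

End SpectralProjection.

(** * Finite forests *)

Section CyclicReduction.
Variables (R : realType) (V E : choiceType) (H : jgraph R V E).

(** A closed non-backtracking walk may still backtrack where it closes up. Stripping its first and
    last edges while they are inverse to each other yields one that can be repeated. *)
Lemma cyclic_reduction e q : path (nb_step H) e q ->
  gtgt H (last e q) = gsrc H e ->
  exists f s, path (nb_step H) f (rcons s f).
Proof.
have [n] := ubnP (size q); elim: n q e => // n IH q e /ltnSE qn pq eq.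
have [le|le] := eqVneq (last e q) (ginv H e); last first.
  by exists e, q; rewrite rcons_path pq /nb_step eq eqxx le.
case/lastP: q qn pq eq le => [|q g] qn pq eq /=.
  by move/eqP; rewrite eq_sym (negbTE (ginv_neq H e)).
rewrite last_rcons => ge; case: q qn pq eq => [|f q] qn pq eq.
  by move: pq; rewrite /= /nb_step ge ginvK eqxx andbF.
move: pq qn; rewrite rcons_cons /= rcons_path size_rcons.
case/andP=> /andP[/eqP ef _] /andP[pq /andP[/eqP lg _]] qn.
apply: (IH q f) => //; first exact: ltnW.
by rewrite lg ge gsrc_inv ef.
Qed.

Lemma long_nb_walks : ~ acyclic H ->
  exists e, forall n, exists2 q, path (nb_step H) e q & (n <= size q)%N.
Proof.
move/contrapT => [e0 [q0 [p0 l0]]]; have [e [s ps]] := cyclic_reduction p0 l0.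
exists e => n; exists (flatten (nseq n (rcons s e))).
  by elim: n => //= n IH; rewrite cat_path ps last_rcons.
by elim: n => //= n IH; rewrite size_cat size_rcons; lia.
Qed.

End CyclicReduction.

Section Forest.
Variables (R : realType) (V E : finType) (H : jgraph R V E).
Local Notation adj := (Defs.adjacent H).
Local Notation conn := (connect adj).

Lemma adjacentP u v : reflect (exists2 e, gsrc H e = u & gtgt H e = v) (adj u v).
Proof.
apply: (iffP existsP) => [[e /andP[/eqP su /eqP tv]]|[e su tv]]; exists e => //.
by rewrite su tv !eqxx.
Qed.

Lemma adjacent_sym : symmetric adj.
Proof.
by move=> u v; apply/adjacentP/adjacentP => -[e su tv]; exists (ginv H e);
  rewrite ?gsrc_inv ?gtgt_inv.
Qed.

Lemma conn_sym : connect_sym adj.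
Proof. exact: sym_connect_sym adjacent_sym. Qed.

Lemma conn_edge e : conn (gsrc H e) (gtgt H e).
Proof. by apply: connect1; apply/adjacentP; exists e. Qed.

Lemma conn_walk u v : conn u v ->
  exists2 q, nb_walk H u q & walk_end H u q = v.
Proof.
case/connectP => s + ->.
suff: path adj u s -> exists2 q, walk H u q & walk_end H u q = last u s.
  by move=> h /h[q wq eq]; have [nq eq'] := wact_nil_walk wq;
     exists (wact H [::] q) => //; rewrite eq'.
elim: s u => [|w s IH] u /=; first by exists [::].
case/andP => /adjacentP[e su tw] /IH[q wq eq].
by exists (e :: q); rewrite /= ?su ?eqxx ?tw // walk_end_cons tw.
Qed.

(** [fingraph.root] selects one vertex in each component; [t u] is a reduced walk from it to [u],
    unique when the graph is acyclic. *)
Definition is_forest_walk (t : V -> seq E) := forall u,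
  nb_walk H (fingraph.root adj u) (t u)
  /\ walk_end H (fingraph.root adj u) (t u) = u.

Lemma forest_walk_ex : exists t, is_forest_walk t.
Proof.
suff /choice[t tP] : forall u, exists q, nb_walk H (fingraph.root adj u) q
  /\ walk_end H (fingraph.root adj u) q = u by exists t.
move=> u; have /conn_walk[q nq eq] : conn (fingraph.root adj u) u.
  by rewrite conn_sym connect_root.
by exists q.
Qed.

Section ForestWalk.
Variable t : V -> seq E.
Hypothesis tP : is_forest_walk t.
Hypothesis acyc : acyclic H.

Lemma root_edge e : fingraph.root adj (gsrc H e) = fingraph.root adj (gtgt H e).
Proof. exact/(fingraph.rootP conn_sym)/conn_edge. Qed.

Lemma forest_walk_step e : t (gtgt H e) = wstep H (t (gsrc H e)) e.
Proof.
have [nt et] := tP (gtgt H e); have [ns es] := tP (gsrc H e).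
apply: (acyclic_nb_unique acyc nt).
  by rewrite -root_edge; apply: wstep_nb ns _; rewrite es.
by rewrite et -root_edge (wstep_end ns) // es.
Qed.

(** Orientation of the edges away from the root of their tree. *)
Definition away e := t (gtgt H e) == rcons (t (gsrc H e)) e.

Lemma away_inv e : away (ginv H e) = ~~ away e.
Proof.
rewrite /away gsrc_inv gtgt_inv forest_walk_step /wstep.
case: ifPn => [/last_ginvP tE|_].
  move: (take _ _) tE => w ->; rewrite eqxx; apply/esym/negP => /eqP/(congr1 size)/eqP.
  by rewrite !size_rcons; lia.
rewrite eqxx; apply/negbTE/eqP => /(congr1 size)/eqP.
by rewrite !size_rcons; lia.
Qed.

Lemma away_inj : {in away &, injective (gtgt H)}.
Proof.
by move=> e f /eqP ae /eqP af tef; move: ae; rewrite tef af => /rcons_inj[_ ->].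
Qed.

(** A vertex other than a root is the target of the last edge of its walk, while the walk of a root
    is closed and hence empty. *)
Lemma image_away : [set gtgt H e | e in away]%SET = [set u | ~~ roots adj u]%SET.
Proof.
apply/setP => u; rewrite inE; apply/imsetP/idP => [[e /eqP ae ->]|ru].
  apply/negP => /eqP re; have [nt et] := tP (gtgt H e); rewrite re in nt et.
  have := acyclic_nb_closed acyc nt et.
  by rewrite ae => /(congr1 size); rewrite size_rcons.
have [nt et] := tP u; case/lastP E0: (t u) => [|w f].
  by move: et ru; rewrite E0 /walk_end /= /roots => ->; rewrite eqxx.
rewrite E0 in nt et; rewrite walk_end_rcons in et.
have := nb_walk_walk nt; rewrite walk_rcons => /andP[_ /eqP sf].
exists f => //; apply/eqP; rewrite et E0; congr rcons.
have [ns es] := tP (gsrc H f).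
apply: (acyclic_nb_unique acyc _ ns); last by rewrite es root_edge et sf.
by rewrite root_edge et; exact: nb_walk_rcons nt.
Qed.

End ForestWalk.

Lemma card_components : #|components H| = #|roots adj|.
Proof.
rewrite /components /equivalence_partition.
have eqc u v : conn u v -> conn u =1 conn v by exact: same_connect conn_sym _ _.
rewrite -(@card_in_imset _ _ (fun u => [set v in [set: V] | conn u v]%SET) (roots adj)).
  apply: eq_card => B; apply/imsetP/imsetP => -[u _ ->].
    exists (fingraph.root adj u); first exact: roots_root conn_sym u.
    by apply/setP => v; rewrite !inE (same_connect conn_sym (connect_root _ u)).
  by exists u; rewrite ?inE.
move=> u v /eqP ru /eqP rv /setP/(_ v); rewrite !inE connect0 => /esym.
by move=> uv; rewrite -ru -rv; apply/(fingraph.rootP conn_sym).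
Qed.

(** The edges pointing away from the roots correspond to the vertices that are not roots, and each
    undirected edge has one such direction. The factors 2 appear because [E] counts directed
    edges. *)
Lemma euler_forest : acyclic H -> (#|V| * 2 = #|components H| * 2 + #|E|)%N.
Proof.
move=> acyc; have [t tP] := forest_walk_ex; rewrite card_components.
pose D := [set e | away t e]%SET.
have cD : #|D| = (#|V| - #|roots adj|)%N.
  have := card_in_imset (away_inj (t := t)); rewrite image_away // => h.
  have -> : #|D| = #|away t| by apply: eq_card => e; rewrite inE.
  rewrite -h -(cardC (roots adj)) addKn.
  by apply: eq_card => u; rewrite inE.
have cE : #|E| = (#|D| * 2)%N.
  rewrite -(cardC (mem D)) muln2 -addnn; congr (_ + _)%N.
  rewrite -(fintype.card_image (can_inj (ginvK H)) (mem D)); apply: eq_card => e.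
  rewrite !inE; apply/idP/fintype.imageP => [ae|[f]].
    by exists (ginv H e); rewrite ?ginvK // inE (away_inv tP acyc).
  by rewrite inE => af ->; rewrite (away_inv tP acyc) negbK.
have := max_card (roots adj); lia.
Qed.

End Forest.

(** * Jacobi operators of finite and induced graphs *)

Section FiniteJacobi.
Variables (R : realType) (V E : finType) (G : jgraph R V E).

Lemma jacobi_tgt (f : V -> R[i]) v : jacobi G f v = (gpot G v)%:C * f v
  + \sum_(e | gtgt G e == v) gwt G e * f (gsrc G e).
Proof.
rewrite /jacobi; congr (_ + _); apply: fsbig_fin => e; split=> /eqP //.
Qed.

Lemma jacobi_src (f : V -> R[i]) v : jacobi G f v = (gpot G v)%:C * f v
  + \sum_(e | gsrc G e == v) gwt G (ginv G e) * f (gtgt G e).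
Proof.
rewrite jacobi_tgt (reindex_inj (can_inj (ginvK G))) /=; congr (_ + _).
by apply: eq_big => e; rewrite ?gtgt_inv // gsrc_inv.
Qed.

End FiniteJacobi.

Section InducedJacobi.
Variables (R : realType) (V E : finType) (G : jgraph R V E) (Y : {pred V}).
Local Notation GY := (induced_graph G Y).

Definition extend (eta : induced_vertex Y -> R[i]) (v : V) : R[i] :=
  oapp eta 0 (insub v).

Lemma extend_val eta u : extend eta (val u) = eta u.
Proof. by rewrite /extend valK. Qed.

Lemma extend_out eta v : v \notin Y -> extend eta v = 0.
Proof. by move=> vY; rewrite /extend insubN. Qed.

Lemma edge_lift e : gsrc G e \in Y -> gtgt G e \in Y ->
  exists e' : induced_edge G Y, val e' = e.
Proof.
by move=> se te; have h : (gsrc G e \in Y) && (gtgt G e \in Y); [apply/andP|exists (Sub e h)].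
Qed.

Lemma jacobi_induced (eta : induced_vertex Y -> R[i]) u :
  jacobi GY eta u = jacobi G (extend eta) (val u).
Proof.
rewrite !jacobi_tgt extend_val; congr (_ + _).
pose Q e := (gtgt G e == val u) && (gsrc G e \in Y).
have -> : \sum_(e | gtgt G e == val u) gwt G e * extend eta (gsrc G e)
    = \sum_(e | Q e) gwt G e * extend eta (gsrc G e).
  rewrite [RHS]big_mkcondr /=; apply: eq_bigr => e _.
  by case: ifPn => // sY; rewrite extend_out // mulr0.
rewrite (reindex_omap (val : induced_edge G Y -> E) insub) => [|e]; last first.
  case/andP=> /eqP te sY; rewrite insubT /= ?sY ?te ?(valP u) //.
apply: eq_big => [e|e _]; last by rewrite -extend_val.
rewrite valK eqxx andbT /Q -val_eqE /=.
by case/andP: (valP e) => -> _; rewrite andbT.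
Qed.

End InducedJacobi.

(** * Lifting an acyclic induced subgraph to the cover *)

Section LiftForest.
Variables (R : realType) (V E : finType) (G : jgraph R V E) (r : V).
Variable X : {set V}.
Local Notation T := (cover_vertex G r).
Local Notation tend := (@cover_vmap R V E G r).
Local Notation GX := (induced_graph G X).

Lemma walk_map_val (u : induced_vertex X) (q : seq (induced_edge G X)) :
  walk GX u q -> walk G (val u) (map val q)
    /\ walk_end G (val u) (map val q) = val (walk_end GX u q).
Proof.
elim: q u => //= e q IH u /andP[/eqP se /IH[wq eq]].
by split; [rewrite -se eqxx|rewrite walk_end_cons].
Qed.

Lemma nb_walk_map_val (u : induced_vertex X) (q : seq (induced_edge G X)) :
  nb_walk GX u q -> nb_walk G (val u) (map val q).
Proof.
case: q => //= e q /andP[/eqP se pq]; apply/andP; split; first by rewrite -se.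
rewrite path_map; apply: sub_path pq => a b /andP[/eqP ab n].
by apply/andP; split=> //=; apply/eqP; exact: (congr1 val ab).
Qed.

(** Each component root is lifted arbitrarily, and every other vertex by following its walk from the
    root. Uniqueness of these walks makes the lifts compatible with all edges. *)
Lemma forest_lift : gconnected G -> acyclic GX ->
  exists s : induced_vertex X -> T, (forall u, tend (s u) = val u)
    /\ forall e, s (gtgt GX e) = step (s (gsrc GX e)) (val e).
Proof.
move=> connG acyc; have [t tP] := forest_walk_ex GX.
have [L LE] := choice (cover_lift r connG).
pose rt u := fingraph.root (Defs.adjacent GX) u.
pose s u := act (L (val (rt u))) (map val (t u)).
have sE u : walk G (tend (L (val (rt u)))) (map val (t u)) /\ tend (s u) = val u.
  have [nt et] := tP u; have [wt we] := walk_map_val (nb_walk_walk nt).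
  by rewrite -(LE (val (rt u))) in wt we; split=> //; rewrite act_end // we et.
exists s; split=> [u|e]; first by case: (sE u).
have [nt et] := tP (gsrc GX e).
rewrite /s /rt -(@root_edge _ _ _ GX e) (forest_walk_step tP acyc).
rewrite /wstep; case: ifPn => [/last_ginvP tE|_]; last by rewrite map_rcons act_rcons.
have [ws es] := sE (gsrc GX e); move: ws; rewrite /rt.
move: (take _ _) tE => w ->; rewrite map_rcons act_rcons walk_rcons.
case/andP=> ww /eqP sw; rewrite -[val e in RHS](ginvK G).
by rewrite stepK // act_end.
Qed.

End LiftForest.

(** * A criterion for multiplicity one *)

Section SimpleEigenvalue.
Variables (R : realType) (V E : finType) (H : jgraph R V E) (lam : R).

Lemma multiplicity_eq1 (phi : {ffun V -> R[i]^o}) : phi != 0 ->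
  (forall v, jacobi H phi v = lam%:C * phi v) ->
  (forall eta : V -> R[i], (forall v, jacobi H eta v = lam%:C * eta v) ->
    exists k, forall v, eta v = k * phi v) ->
  multiplicity H lam = 1%N.
Proof.
move=> phi0 phiE simple; rewrite /multiplicity.
suff -> : passmx.leigenspace (linfun (jacobi_ffun H)) lam%:C = <[phi]>%VS.
  by rewrite dim_vline phi0.
apply/vspaceP => eta; rewrite memv_ker add_lfunE opp_lfunE scale_lfunE id_lfunE lfunE /=.
rewrite subr_eq0; apply/eqP/vlineP => [e|[k ->]].
  have [v|k etak] := simple eta.
    by have := congr1 (fun g : {ffun V -> R[i]^o} => g v) e; rewrite !ffunE.
  by exists k; apply/ffunP => v; rewrite etak ffunE.
rewrite linearZ scalerA mulrC -scalerA; congr (_ *: _).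
by apply/ffunP => v; rewrite !ffunE phiE.
Qed.

End SimpleEigenvalue.

(** * The kernel on the cover *)

Section KernelOnTree.
Variables (R : realType) (V E : finType) (G : jgraph R V E) (r : V).
Local Notation T := (cover_vertex G r).
Local Notation tend := (@cover_vmap R V E G r).
Local Notation A := (jacobi (universal_cover G r)).
Implicit Types (p q v w x : T) (e f : E) (y z : T -> R[i]).

Hypothesis wt_neq0 : forall e, gwt G e != 0.
Variable lam : R.
(** From here on only the reproducing functions [xi], the projection [P] and the atoms [m] are used.
    They stand for [repr_kernel], [proj] and [atom], so the functional calculus no longer
    appears. *)
Variables (xi : T -> T -> R[i]) (P : (T -> R[i]) -> T -> R[i]) (m : V -> R).
Local Notation ker := (in_kernel lam).
Hypothesis A_sym : forall y z, l2 y -> l2 z -> inner (A y) z = inner y (A z).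
Hypothesis xi_ker : forall w, ker (xi w).
Hypothesis xi_repr : forall w z, ker z -> inner (xi w) z = z w.
Hypothesis P_ker : forall z, l2 z -> ker (P z).
Hypothesis xi_P : forall w z, l2 z -> inner (xi w) z = P z w.
Hypothesis xi_diag : forall p, xi p p = (m (tend p))%:C.

Lemma conjC_real (a : R) : (a%:C)^*%R = a%:C :> R[i].
Proof. by apply/eqP; rewrite eq_complex /= oppr0 !eqxx. Qed.

Lemma conj_scale (a : R) (b : R[i]) : (a%:C * b)^*%R = a%:C * b^*.
Proof.
case: b => b b'; apply/eqP; rewrite eq_complex /=.
by apply/andP; split; apply/eqP; ring.
Qed.

Lemma real_complex_inj (a b : R) : a%:C = b%:C :> R[i] -> a = b.
Proof. by case. Qed.

Lemma sqmod_real (a : R) : sqmod a%:C = a ^+ 2.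
Proof. by rewrite /sqmod /= expr0n /= addr0. Qed.

Lemma sqmod0 : sqmod (0 : R[i]) = 0.
Proof. by rewrite /sqmod /= expr0n /= addr0. Qed.

Lemma xi_l2 w : l2 (xi w). Proof. by case: (xi_ker w). Qed.

Lemma xi_conj v w : xi v w = (xi w v)^*%R.
Proof. by rewrite -(xi_repr v (xi_ker w)) -(xi_repr w (xi_ker v)) -inner_conj. Qed.

Lemma nnsum_xi_fin w S : (nnsum S (@sqmod R \o xi w) \is a fin_num).
Proof.
apply: nnsum_fin => [v|]; first exact: sqmod_ge0.
have /l2E := xi_l2 w; apply: le_lt_trans; rewrite nnsum_mkcond.
by apply: nnsum_le => v; case: ifP => // _; exact: sqmod_ge0.
Qed.

Lemma m_mass p : m (tend p) = fine (nnsum setT (@sqmod R \o xi p)).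
Proof.
apply: real_complex_inj.
by rewrite -xi_diag -inner_self (xi_repr p (xi_ker p)).
Qed.

Lemma m_ge0 p : 0 <= m (tend p).
Proof. by rewrite m_mass fine_ge0 // nnsum_ge0 // => v; exact: sqmod_ge0. Qed.

(** The squared norm of [xi p] is [m (tend p)], so [xi p] is zero, and [z p] is its inner product
    with [z]. *)
Lemma ker_vanish z p : ker z -> ~~ (0 < m (tend p)) -> z p = 0.
Proof.
move=> kz; rewrite -leNgt => mp.
rewrite -(xi_repr p kz); apply: inner0 => v.
rewrite (@l2norm_eq0 _ _ (xi p) (xi_l2 p)) ?conjC0 ?mul0r //.
by apply/eqP; rewrite /l2norm sqrtr_eq0; move: mp; rewrite m_mass.
Qed.

(** * Truncation to a branch and the Wronskian identity *)

Lemma jacobi_lin (c : R[i]) y z v :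
  A (fun w => y w + c * z w) v = A y v + c * A z v.
Proof.
rewrite !jacobi_cover.
under eq_bigr => e _ do rewrite mulrDr mulrCA.
rewrite big_split /= -mulr_sumr; ring.
Qed.

(** Truncation commutes with [A] except at the ends of the removed edge: [p], outside the branch,
    still receives the term from [step p e], while [step p e] loses the term from [p]. *)
Lemma jacobi_restrict y p e v : gsrc G e = tend p ->
  A (restrict (branch p e) y) v =
    restrict (branch p e) (A y) v
    + gwt G (ginv G e) * y (step p e) * Defs.delta R p v
    - gwt G e * y p * Defs.delta R (step p e) v.
Proof.
move=> se; set q := step p e.
have resE z x : restrict (branch p e) z x = if branch p e x then z x else 0.
  by rewrite /restrict; case: (branch p e x) => /=; [rewrite asboolT|rewrite asboolF].
have pq : p != q.
  by apply/eqP => pq; have := branch_step se; rewrite -/q -pq branch_base.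
have sq := step_src se.
rewrite resE !jacobi_cover resE.
have [vp|vp] := eqVneq v p.
  subst v; rewrite branch_base mulr0 !add0r /Defs.delta eqxx (negbTE pq) mulr1 mulr0 subr0.
  rewrite (bigD1 e) /= ?se // resE branch_step // big1 ?addr0 // => f /andP[/eqP sf fe].
  rewrite resE branch_stepE //; first by rewrite branch_base mulr0.
    by rewrite xpair_eqE eqxx.
  by rewrite xpair_eqE (negbTE pq).
rewrite /Defs.delta (negbTE vp) mulr0 addr0.
have [vq|vq] := eqVneq v q.
  subst v; rewrite branch_step // mulr1 -addrA; congr (_ + _).
  rewrite (bigD1 (ginv G e)) /= ?sq // [in RHS](bigD1 (ginv G e)) /= ?sq //.
  rewrite resE (stepK se) branch_base mulr0 add0r ginvK addrAC subrr add0r.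
  apply: eq_bigr => f /andP[/eqP sf fe].
  rewrite resE branch_stepE //; first by rewrite branch_step.
    by rewrite xpair_eqE eq_sym (negbTE pq).
  by rewrite xpair_eqE eqxx.
rewrite mulr0 subr0.
rewrite (eq_bigr (fun f => if branch p e v then gwt G (ginv G f) * y (step v f) else 0)).
  by case: ifP => // _; rewrite mulr0 big1 ?addr0.
move=> f /eqP sf; rewrite resE branch_stepE //; first by case: ifP => // _; rewrite mulr0.
  by rewrite xpair_eqE (negbTE vp).
by rewrite xpair_eqE (negbTE vq).
Qed.

(* The bilinear form [inner z ((A - lam) y')], with [y'] the truncation of [y] to
   a branch, vanishes by self-adjointness; only the two ends of the removed edge
   contribute to it. *)
Lemma wronskian z y p e : ker z -> l2 y -> gsrc G e = tend p ->
  (forall v, (z v)^* * (A y v - lam%:C * y v) = 0) ->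
  (z p)^* * (gwt G (ginv G e) * y (step p e)) = (z (step p e))^* * (gwt G e * y p).
Proof.
move=> [lz Az] ly se zy; set q := step p e.
pose b := restrict (branch p e) y; have lb : l2 b by exact: l2_restrict.
pose c1 := gwt G (ginv G e) * y q; pose c2 := - (gwt G e * y p).
pose d1 v := c1 * Defs.delta R p v; pose d2 v := c2 * Defs.delta R q v.
have l1 : l2 d1 by apply: l2Z; exact: l2_delta.
have l2' : l2 d2 by apply: l2Z; exact: l2_delta.
have lbl : l2 (fun v => lam%:C * b v) by exact: l2Z.
have ld : l2 (fun v => d1 v + d2 v) by exact: l2D.
have h : inner z (A b) = inner z (fun v => lam%:C * b v + (d1 v + d2 v)).
  apply: inner_ext => v; rewrite jacobi_restrict //.
  rewrite /d1 /d2 /c1 /c2 /b /restrict; case: ifP => _.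
    by apply/eqP; rewrite -subr_eq0; apply/eqP; rewrite -[RHS](zy v); ring.
  by rewrite mulr0; congr (_ * _); ring.
have : inner (A z) b = inner z (fun v => lam%:C * b v).
  have h1 v : (A z v)^* * b v = (z v)^* * (lam%:C * b v).
    by rewrite Az conj_scale -mulrA mulrCA.
  by rewrite /inner; congr (_ +i* _); congr rsum; apply/funext => v;
    rewrite h1.
rewrite A_sym // h innerDr // => /eqP; rewrite -subr_eq0 addrAC subrr add0r.
rewrite innerDr // /d1 /d2 !innerZr ?inner_delta //; try exact: l2_delta.
by rewrite /c2 mulNr subr_eq0 /c1 => /eqP; rewrite mulrC => ->; rewrite mulrC.
Qed.

(** The Wronskian identity against [xi p] determines [z q] from [z p], since [xi p p] and the weight
    are nonzero. Applied to [xi q] and to [xi p], which satisfy [xi q p = (xi p q)^*], the ratio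
    gives [m] at [q] as [sqmod c] times [m] at [p]. *)
Lemma kernel_ratio p e : gsrc G e = tend p -> 0 < m (tend p) ->
  exists c : R[i], (forall z, ker z -> z (step p e) = c * z p)
    /\ m (gtgt G e) = sqmod c * m (tend p).
Proof.
move=> se mp; set q := step p e.
pose c := (xi p q)^* * gwt G e / ((m (tend p))%:C * gwt G (ginv G e)).
have n0 : (m (tend p))%:C * gwt G (ginv G e) != 0 :> R[i].
  by rewrite mulf_neq0 // eq_complex /= eqxx andbT gt_eqF.
have H z : ker z -> z q = c * z p.
  move=> kz; have := @wronskian (xi p) z p e (xi_ker p) _ se _.
  case: (kz) => lz Az /(_ lz); rewrite -/q xi_diag conjC_real.
  move=> h; apply: (mulfI n0); rewrite -mulrA h => [|v]; last by rewrite Az subrr mulr0.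
  by rewrite [RHS]mulrA /c [_ * (_ / _)]mulrC divfK // mulrA.
exists c; split=> //; apply: real_complex_inj.
rewrite -(step_end se) -xi_diag (H _ (xi_ker _)) xi_conj (H _ (xi_ker _)) xi_diag.
by rewrite rmorphM /= conjC_real mulrA [c * _]mulrC mul_conj_sqmod -rmorphM.
Qed.

(** * Masses of branches, the quantities [M(e)] *)

Definition mass p e : R :=
  fine (nnsum (branch p e) (@sqmod R \o xi p)) / m (tend p).

Lemma in_kernel_deck p p' z : tend p = tend p' -> ker z -> ker (z \o deck p p').
Proof.
move=> ends [lz Az]; split; first exact: l2_bij (deck_bij ends) lz.
move=> v /=; rewrite -Az !jacobi_cover deck_end //; congr (_ + _).
by apply: eq_bigr => e /eqP se; rewrite /= deck_step.
Qed.

(** Pulling [xi] back by a deck transformation gives a kernel function that reproduces at [w], and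
    [xi w] is the only such function. *)
Lemma xi_deck p p' w u : tend p = tend p' ->
  xi (deck p p' w) (deck p p' u) = xi w u.
Proof.
move=> ends; pose h := xi (deck p p' w) \o deck p p'.
have kh : ker h by apply: in_kernel_deck.
have repr z : ker z -> inner h z = z w.
  move=> kz; have -> : z = (z \o deck p' p) \o deck p p'.
    by apply/funext => v /=; rewrite deckK.
  rewrite inner_bij; last exact: deck_bij.
  by rewrite xi_repr //; apply: in_kernel_deck.
by rewrite -[LHS]/(h u) -(xi_repr u kh) inner_conj repr // -xi_conj.
Qed.

Lemma mass_deck p p' e : tend p = tend p' -> gsrc G e = tend p ->
  mass p e = mass p' e.
Proof.
move=> ends se; rewrite /mass -ends; congr (fine _ / _).
rewrite -[RHS](nnsum_bij _ _ (deck_bij ends)); congr nnsum.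
  by apply/funext => x /=; rewrite /preimage /mkset /= branch_deck.
by apply/funext => x /=; rewrite -(xi_deck _ _ ends) deck_base.
Qed.

(** The branches at [p] partition the other vertices. As [p] itself contributes [m ^+ 2] to the
    total [m], dividing by [m] leaves [1 - m]. *)
Lemma mass_sum p : 0 < m (tend p) ->
  \sum_(e | gsrc G e == tend p) mass p e = 1 - m (tend p).
Proof.
move=> mp; pose F := @sqmod R \o xi p.
have F0 v : 0 <= F v by exact: sqmod_ge0.
have FT : F = fun v => F p * (v == p)%:R
    + \sum_(e <- enum E) (if (gsrc G e == tend p) && branch p e v then F v else 0).
  apply/funext => v; rewrite big_enum /=.
  have [->|vp] := eqVneq v p.
    by rewrite mulr1 big1 ?addr0 // => e _; rewrite branch_base andbF.
  rewrite mulr0 add0r; have [e se be] := branch_ex vp.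
  rewrite (bigD1 e) //= se eqxx be big1 ?addr0 // => f fe.
  case: ifP => // /andP[_ bf]; by rewrite (branch_uniq bf be) eqxx in fe.
have d0 v : 0 <= F p * (v == p)%:R by rewrite mulr_ge0.
have b0 e v : 0 <= (if (gsrc G e == tend p) && branch p e v then F v else 0).
  by case: ifP.
have : m (tend p) = F p + \sum_(e | gsrc G e == tend p) fine (nnsum (branch p e) F).
  rewrite {1}m_mass -/F {1}FT nnsumD // => [|v]; last by apply: sumr_ge0.
  rewrite nnsum_sum // big_enum /=.
  have -> : nnsum setT (fun v => F p * (v == p)%:R) = (F p)%:E.
    transitivity (nnsum [set p] F); last first.
      rewrite (@nnsum_finE _ _ _ [:: p]) ?big_seq1 // => v.
      by rewrite inE; split=> [->|/eqP].
    rewrite [RHS]nnsum_mkcond; congr nnsum; apply/funext => v.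
    have [->|vp] := eqVneq v p; first by rewrite asboolT // mulr1.
    by rewrite asboolF ?mulr0 //; exact/eqP.
  have E1 e : nnsum setT (fun v => if (gsrc G e == tend p) && branch p e v then F v else 0)
     = (if gsrc G e == tend p then fine (nnsum (branch p e) F) else 0)%:E.
    case: ifP => _ /=; last by rewrite /nnsum esum1.
    rewrite fineK ?nnsum_xi_fin // [RHS]nnsum_mkcond; congr nnsum; apply/funext => v.
    by case: (branch p e v) => /=; [rewrite asboolT|rewrite asboolF].
  by under eq_bigr => e _ do rewrite E1; rewrite sumEFin /= -big_mkcond.
move/(congr1 (fun t => t / m (tend p))); rewrite divff ?gt_eqF // mulrDl.
rewrite /F /= xi_diag sqmod_real expr2 mulfK ?gt_eqF // mulr_suml.
by move->; rewrite addrAC subrr add0r.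
Qed.

(** The two branches at an edge are complementary; this moves the mass seen from [step p e] to the
    branch seen from [p]. *)
Lemma mass_inv p e : gsrc G e = tend p -> 0 < m (gtgt G e) ->
  mass (step p e) (ginv G e)
  = 1 - fine (nnsum (branch p e) (@sqmod R \o xi (step p e))) / m (gtgt G e).
Proof.
move=> se me; rewrite /mass step_end //; set q := step p e; set F := _ \o xi q.
have F0 v : 0 <= F v by exact: sqmod_ge0.
apply: (@mulIf _ (m (gtgt G e))); first by rewrite gt_eqF.
rewrite mulrBl !divfK ?gt_eqF // mul1r -(step_end se) m_mass -/q -/F.
apply/eqP; rewrite eq_sym subr_eq -fineD ?nnsum_xi_fin //; apply/eqP; congr fine.
rewrite [X in (X + _)%E]nnsum_mkcond [X in (_ + X)%E]nnsum_mkcond.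
rewrite -nnsumD; try by move=> v; case: ifP.
congr nnsum; apply/funext => v; rewrite branch_compl //.
by case: (branch p e v) => /=;
  [rewrite asboolF // asboolT ?add0r|rewrite asboolT // asboolF ?addr0].
Qed.

(** By [kernel_ratio], [xi (step p e)] is a multiple of [xi p], so both put the same fraction of
    their mass on a given branch. *)
Lemma mass_pair p e : gsrc G e = tend p -> 0 < m (tend p) ->
  0 < m (gtgt G e) -> mass p e + mass (step p e) (ginv G e) = 1.
Proof.
move=> se mp me; rewrite mass_inv //; have [c [H mE]] := kernel_ratio se mp.
have -> : @sqmod R \o xi (step p e) = (fun v => sqmod c * sqmod (xi p v)).
  apply/funext => v /=; rewrite xi_conj (H _ (xi_ker v)) sqmod_conj sqmodM.
  by rewrite -(sqmod_conj (xi v p)) -xi_conj.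
rewrite nnsumZ ?sqmod_ge0 // => [|v]; last exact: sqmod_ge0.
have c0 : sqmod c != 0 by apply: contraTneq me => c0; rewrite mE c0 mul0r ltxx.
have fin := nnsum_xi_fin p (branch p e); rewrite -(fineK fin) -EFinM /= mE.
rewrite /mass -mulf_div divff // mul1r; exact: subrKC.
Qed.

Lemma mass_boundary p e0 : ~~ (0 < m (tend p)) -> gsrc G e0 = tend p ->
  0 < m (gtgt G e0) ->
  \sum_(e | (gsrc G e == tend p) && (0 < m (gtgt G e))) mass (step p e) (ginv G e) = 1.
Proof.
move=> mp se0 me0.
pose y e := restrict (branch p e) (xi (step p e)).
(* Truncating [xi (step p e)] creates at [p] a source equal to the inverse of this constant, so
   [z e] has source exactly [delta] at [p]. The other end creates none, since [xi (step p e)]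
   vanishes at [p]. *)
pose c e : R[i] := (gwt G (ginv G e) * (m (gtgt G e))%:C)^-1.
pose z e v := c e * y e v.
have ly e : l2 (y e) by apply: l2_restrict; exact: xi_l2.
have lz e : l2 (z e) by exact: l2Z.
have mC e : 0 < m (gtgt G e) -> (m (gtgt G e))%:C != 0 :> R[i].
  by move=> me; rewrite eq_complex /= eqxx andbT gt_eqF.
have cK e : 0 < m (gtgt G e) -> c e * (gwt G (ginv G e) * (m (gtgt G e))%:C) = 1.
  by move=> me; rewrite mulVf // mulf_neq0 // mC.
have Az e v : gsrc G e = tend p -> 0 < m (gtgt G e) ->
    A (z e) v = lam%:C * z e v + Defs.delta R p v.
  move=> se me.
  have := jacobi_lin (c e) (fun=> 0) (y e) v.
  rewrite (_ : (fun w => _ + _) = z e); last by apply/funext => w; rewrite add0r.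
  move->; rewrite jacobi_restrict // xi_diag step_end //.
  rewrite (ker_vanish (xi_ker _) mp) mulr0 mul0r subr0 mulrDr [c e * (_ * _)]mulrA cK // mul1r.
  rewrite [A (fun=> 0) v]jacobi_cover mulr0 big1 => [|f _]; last by rewrite mulr0.
  rewrite !add0r; congr (_ + _); rewrite /z /y /restrict; case: ifP => _; rewrite ?mulr0 //.
  by case: (xi_ker (step p e)) => _ ->; ring.
have zp e : z e p = 0 by rewrite /z /y /restrict branch_base asboolF ?mulr0.
pose k := P (z e0); have [lk Ak] : ker k by exact: P_ker.
have kp : k p = 0 by apply: ker_vanish mp; exact: P_ker.
(* The equation [(A - lam) (z e0 - k) = delta] is evaluated at [p], where both [z e0] and [k]
   vanish. It remains to identify each term with a mass. *)
have sum1 : \sum_(e | gsrc G e == tend p)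
    gwt G (ginv G e) * (z e0 (step p e) - k (step p e)) = 1.
  have := Az e0 p se0 me0; have := Ak p; rewrite !jacobi_cover kp zp !mulr0 !add0r.
  rewrite /Defs.delta eqxx => k0 z1.
  by under eq_bigr => e _ do rewrite mulrBr; rewrite big_split /= sumrN k0 z1 subr0.
apply: real_complex_inj; rewrite -[RHS]sum1 rmorph_sum /= [RHS]big_mkcond [LHS]big_mkcond /=.
apply: eq_bigr => e _; case: eqP => //= se; case: ifPn => me; last first.
  have me' : ~~ (0 < m (tend (step p e))) by rewrite step_end.
  rewrite /z /y /restrict (ker_vanish (xi_ker _) me') if_same mulr0.
  by rewrite (ker_vanish _ me') ?subr0 ?mulr0 //; exact: P_ker.
(* Both functions solve the same equation, so their difference is reproduced by [xi]; this allows
   the term at [e] to be computed from [z e] instead of [z e0]. *)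
have kd : ker (fun v => z e v + (-1) * z e0 v).
  split; first by apply: l2D => //; exact: l2Z.
  by move=> v; rewrite jacobi_lin !Az //; ring.
set q := step p e; have lm : l2 (fun v => (-1) * z e0 v) by exact: l2Z.
have ze : inner (xi q) (z e) = c e * inner (xi q) (y e) := innerZr (c e) (xi_l2 q) (ly e).
have kq : inner (xi q) (z e0) = k q := xi_P q (lz e0).
have zeq : z e q = c e * (m (gtgt G e))%:C.
  by rewrite /z /y /restrict branch_step // asboolT // xi_diag step_end.
have := xi_repr q kd.
rewrite (innerDr (xi_l2 q) (lz e) lm) (innerZr (-1) (xi_l2 q) (lz e0)) kq ze zeq.
rewrite inner_restrict mass_inv // -/q; set M := fine _ => h.
have -> : z e0 q - k q = c e * (m (gtgt G e))%:C - c e * M%:C.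
  move/eqP: h; rewrite -subr_eq0 => /eqP h.
  by apply/eqP; rewrite -subr_eq0; apply/eqP; rewrite -[RHS]h; ring.
rewrite -mulrBr mulrA /c invfM mulrA divff // mul1r mulrBr mulVf ?mC //.
by rewrite rmorphB rmorph1 rmorphM /= fmorphV mulrC.
Qed.

(** * Kernel functions along walks, and acyclicity of the support *)

Lemma kernel_walk p (s : seq E) : 0 < m (tend p) -> walk G (tend p) s ->
  all (fun e => 0 < m (gtgt G e)) s ->
  sqmod (xi p (act p s)) = m (tend (act p s)) * m (tend p).
Proof.
move=> mp; elim/last_ind: s => [|s e IH]; first by rewrite /= xi_diag sqmod_real expr2.
rewrite walk_rcons all_rcons act_rcons => /andP[ws /eqP se] /andP[me ms].
have se' : gsrc G e = tend (act p s) by rewrite act_end.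
have mx : 0 < m (tend (act p s)).
  case/lastP: s ws ms {IH se se'} => [//|s f]; rewrite all_rcons => ws /andP[mf _].
  by rewrite act_end // walk_end_rcons.
have [c [H mE]] := kernel_ratio se' mx.
(* Each step multiplies the squared modulus by the quotient of the new [m] by the old one, so the
   product telescopes. *)
by rewrite (H _ (xi_ker p)) sqmodM IH // step_end // mE mulrA.
Qed.

(** The walk visits [(size s).+1] distinct vertices of the tree, counting [p]. Each carries at least
    [d * m (tend p)] of the mass of [xi p], whose total is [m (tend p)]. *)
Lemma kernel_nb_walk_bound p (s : seq E) (d : R) : 0 < m (tend p) ->
  nb_walk G (tend p) s -> all (fun e => 0 < m (gtgt G e)) s ->
  (forall u, 0 < m u -> d <= m u) -> d *+ (size s).+1 <= 1.
Proof.
move=> mp ns ms dm.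
have wt i : walk G (tend p) (take i s).
  by move: (nb_walk_walk ns); rewrite -{1}(cat_take_drop i s) walk_cat => /andP[].
have mt i : all (fun e => 0 < m (gtgt G e)) (take i s).
  by move: ms; rewrite -{1}(cat_take_drop i s) all_cat => /andP[].
have mx i : 0 < m (tend (act p (take i s))).
  case/lastP: (take i s) (wt i) (mt i) => [//|s' f]; rewrite all_rcons => ws /andP[mf _].
  by rewrite act_end // walk_end_rcons.
pose D := [seq act p (take i s) | i <- iota 0 (size s).+1].
(* A repeated vertex would be fixed by the segment of [s] between its two visits, and [act_free]
   makes that segment empty. *)
have uD : uniq D.
  rewrite map_inj_in_uniq ?iota_uniq // => i j; rewrite !mem_iota /= !add0n !ltnS.
  wlog ij : i j / (i <= j)%N => [H|].
    by case: (leqP i j) => [/H //|/ltnW ji ii jj /esym eij]; apply/esym/(H j i).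
  move=> si sj; have tj : take j s = take i s ++ drop i (take j s).
    by rewrite -{1}(cat_take_drop i (take j s)) take_takel.
  rewrite tj act_cat => /esym /act_free.
  have nbd : nb_walk G (tend (act p (take i s))) (drop i (take j s)).
    rewrite act_end //; have : nb_walk G (tend p) (take i s ++ drop i (take j s)).
      by rewrite -tj; apply: (@nb_walk_prefix _ _ _ _ _ _ (drop j s)); rewrite cat_take_drop.
    case: (take i s) => [//|a l]; rewrite cat_cons /= cat_path => /andP[_ /andP[_]].
    rewrite walk_end_cons /walk_end last_map /=.
    by case: (drop _ _) => //= b l' /andP[/andP[/eqP -> _] ->]; rewrite eqxx.
  move=> /(_ nbd) /(congr1 size); rewrite size_drop size_takel // => /eqP; rewrite subn_eq0 => ji.
  by apply/eqP; rewrite eqn_leq ij.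
have F0 v : 0 <= (@sqmod R \o xi p) v by exact: sqmod_ge0.
have := @nnsum_ge_seq _ _ setT D _ uD (fun _ _ => I) F0.
rewrite -[X in (_ <= X)%E]fineK ?nnsum_xi_fin // lee_fin -m_mass big_map => h.
rewrite -(ler_pM2r mp) mul1r; apply: le_trans h.
rewrite mulrnAl; apply: (@le_trans _ _ (\sum_(i <- iota 0 (size s).+1) d * m (tend p))).
  by rewrite big_const_seq count_predT size_iota iter_addr_0.
by apply: ler_sum => i _ /=; rewrite kernel_walk // ler_wpM2r ?dm // ltW.
Qed.

Hypothesis connG : gconnected G.

Definition kernel_support : {set V} :=
  [set u | 0 < m u]%SET.
Local Notation X := kernel_support.
Local Notation GX := (induced_graph G X).

Lemma kernel_supportE u : (u \in X) = (0 < m u). Proof. by rewrite inE. Qed.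

Lemma kernel_support_min : exists2 d : R, 0 < d & forall u, 0 < m u -> d <= m u.
Proof.
(* [S] exceeds every inverse of a positive value of [m]; the summand 1 keeps it positive when there
   is no such value. *)
pose S := 1 + \sum_(u | 0 < m u) (m u)^-1.
have S0 : 0 < S.
  by rewrite ltr_pwDl // sumr_ge0 // => u mu; rewrite invr_ge0 ltW.
exists S^-1 => [|u mu]; first by rewrite invr_gt0.
rewrite -[leRHS]invrK lef_pV2 ?posrE ?invr_gt0 // /S (bigD1 u) //=.
have s0 : 0 <= \sum_(i | (0 < m i) && (i != u)) (m i)^-1.
  by apply: sumr_ge0 => i /andP[mi _]; rewrite invr_ge0 ltW.
by rewrite addrCA lerDl addr_ge0.
Qed.

(** A cycle would give arbitrarily long non-backtracking walks inside the support, against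
    [kernel_nb_walk_bound]. *)
Lemma kernel_support_acyclic : acyclic GX.
Proof.
have [//|nacyc] := pselect (acyclic GX); have [e walks] := long_nb_walks nacyc.
have [d d0 dm] := kernel_support_min.
have [p pE] := cover_lift r connG (gsrc G (val e)).
have /andP[sX tX] := valP e; rewrite !kernel_supportE in sX tX.
have [q pq sq] := walks (Num.bound d^-1).
have ne : nb_walk GX (gsrc GX e) (e :: q) by rewrite /= eqxx.
have := nb_walk_map_val ne; rewrite [val (gsrc GX e)]/= -pE => ns.
have mp : 0 < m (tend p) by rewrite pE.
have ms : all (fun f => 0 < m (gtgt G f)) (map val (e :: q)).
  by rewrite all_map; apply/allP => f _ /=; have /andP[_] := valP f; rewrite kernel_supportE.
have := kernel_nb_walk_bound mp ns ms dm; rewrite leNgt => /negP[].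
rewrite size_map -[X in X < _](mulVf (lt0r_neq0 d0)) mulrC -mulr_natr ltr_pM2l //.
apply: lt_le_trans (archi_boundP _) _; first by rewrite invr_ge0 ltW.
by rewrite ler_nat; apply: (leq_trans sq); exact: leqW (leqnSn _).
Qed.

(** * Simplicity of [lam] on a component of the support *)

Section Multiplicity.
Variable C : {set induced_vertex X}.
Hypothesis compC : C \in components GX.
Local Notation HC := (induced_graph GX C).

Lemma component_conn (u v : induced_vertex X) : u \in C ->
  (v \in C) = connect (Defs.adjacent GX) u v.
Proof.
case/imsetP: compC => w _ ->; rewrite !inE => wu.
exact: same_connect (conn_sym GX) _ _ wu v.
Qed.

Lemma component_edge (e : induced_edge G X) : (gsrc GX e \in C) = (gtgt GX e \in C).
Proof.
apply/idP/idP => h; first by rewrite (component_conn _ h) conn_edge.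
by rewrite (component_conn _ h) (conn_sym GX) conn_edge.
Qed.

Variable s : induced_vertex X -> T.
Hypothesis s_end : forall u, tend (s u) = val u.
Hypothesis s_step : forall e : induced_edge G X,
  s (gtgt GX e) = step (s (gsrc GX e)) (val e).

Lemma s_src (e : induced_edge G X) : gsrc G (val e) = tend (s (gsrc GX e)).
Proof. by rewrite s_end. Qed.

Lemma m_s u : 0 < m (tend (s u)).
Proof. by rewrite s_end; have := valP u; rewrite kernel_supportE. Qed.

(** Places [eta] on the one copy of [X] chosen by [s]; all other points of the cover, including the
    other points over [X], get 0. *)
Definition lift_fun (eta : induced_vertex X -> R[i]) (x : T) : R[i] :=
  if insub (tend x) is Some u then if x == s u then eta u else 0 else 0.

Lemma lift_fun_s eta u : lift_fun eta (s u) = eta u.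
Proof. by rewrite /lift_fun s_end valK eqxx. Qed.

Lemma lift_fun_l2 eta : l2 (lift_fun eta).
Proof.
apply: (@l2_fin _ _ [seq s u | u <- enum {: induced_vertex X}]) => x xD.
rewrite /lift_fun; case: insubP => // u _ _; case: eqP => // xs.
by case/mapP: xD; exists u; rewrite ?mem_enum.
Qed.

Lemma lift_fun_step eta u e : gsrc G e = tend (s u) ->
  lift_fun eta (step (s u) e) = extend eta (gtgt G e).
Proof.
move=> se; rewrite /lift_fun step_end // /extend.
case: insubP => // w wX wE /=.
have sX : gsrc G e \in X by rewrite se s_end (valP u).
have [e' e'E] := edge_lift sX wX.
have us : gsrc GX e' = u by apply: val_inj; rewrite /= e'E se s_end.
have ws : gtgt GX e' = w by apply: val_inj; rewrite /= e'E wE.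
by rewrite -ws s_step us e'E eqxx.
Qed.

Lemma jacobi_lift eta u : A (lift_fun eta) (s u) = jacobi GX eta u.
Proof.
rewrite jacobi_induced jacobi_cover jacobi_src lift_fun_s s_end extend_val.
by congr (_ + _); apply: eq_bigr => e /eqP se; rewrite lift_fun_step // se s_end.
Qed.

Lemma jacobi_component (eta : induced_vertex C -> R[i]) u : u \in C ->
  exists2 u' : induced_vertex C, val u' = u & jacobi HC eta u' = jacobi GX (extend eta) u.
Proof. by move=> uC; exists (Sub u uC) => //; rewrite [LHS]jacobi_induced. Qed.

(* The error [A y - lam y] of the lift [y] of an eigenfunction on [C] is kernel_supported
   where all kernel functions vanish. *)
Lemma lift_eigen (eta : induced_vertex C -> R[i]) z v :
  (forall u, jacobi HC eta u = lam%:C * eta u) -> ker z ->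
  (z v)^* * (A (lift_fun (extend eta)) v - lam%:C * lift_fun (extend eta) v) = 0.
Proof.
move=> eigen kz; set y := lift_fun _.
have [mv|mv] := boolP (0 < m (tend v)); last first.
  by rewrite (ker_vanish kz mv) conjC0 mul0r.
have vX : tend v \in X by rewrite kernel_supportE.
pose u : induced_vertex X := Sub (tend v) vX.
have [vs|vs] := eqVneq v (s u); last first.
  have y0 : y v = 0.
    rewrite /y /lift_fun; case: insubP => // w wX wE.
    by rewrite (_ : w = u) ?(negbTE vs) //; exact: val_inj.
  (* A point over [X] outside the chosen copy has no neighbour in it, for [s_step] along the joining
     edge would place the point itself in the copy. *)
  suff Ay0 : A y v = 0 by rewrite Ay0 y0 mulr0 subr0 mulr0.
  rewrite jacobi_cover y0 mulr0 add0r big1 // => e /eqP se.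
  rewrite [y _]/y /lift_fun step_end //; case: insubP; rewrite ?mulr0 // => w wX wE.
  case: eqP => [sw|_]; rewrite ?mulr0 //.
  have sX : gsrc G e \in X by rewrite se.
  case/eqP: vs; have [e' e'E] := edge_lift sX wX.
  have us : gsrc GX e' = u by apply: val_inj; rewrite /= e'E se.
  have ws : gtgt GX e' = w by apply: val_inj; rewrite /= e'E wE.
  rewrite -(stepK se) sw -ws s_step us e'E stepK //.
  by rewrite se s_end.
rewrite vs /y jacobi_lift lift_fun_s.
case: (boolP (u \in C)) => uC.
  have [u' u'E <-] := jacobi_component eta uC.
  by rewrite eigen -u'E extend_val subrr mulr0.
(* A vertex of [X] outside the component [C] has no neighbour in [C], so every term vanishes. *)
rewrite [extend eta u]extend_out // mulr0 subr0 jacobi_src.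
rewrite [extend eta u]extend_out // mulr0 add0r big1 ?mulr0 //.
move=> e /eqP se; rewrite extend_out ?mulr0 //.
by rewrite -component_edge se.
Qed.

Lemma multiplicity_component : multiplicity HC lam = 1%N.
Proof.
have [u0 u0C] : exists u, u \in C.
  by case/imsetP: compC => w _ ->; exists w; rewrite !inE connect0.
pose z := xi (s u0).
have kz : ker z by exact: xi_ker.
have z0 : z (s u0) != 0.
  by rewrite /z xi_diag eq_complex /= eqxx andbT gt_eqF ?m_s.
(* The ratio along an edge inside [X] is nonzero because [m] is positive at its far end, so
   nonvanishing spreads over the component. *)
have zC u : u \in C -> z (s u) != 0.
  rewrite (component_conn _ u0C) => /connectP[q + ->].
  elim/last_ind: q => [//|q w IH]; rewrite rcons_path last_rcons => /andP[/IH zl].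
  case/adjacentP => e sl <-; rewrite s_step.
  have [|c [H mE]] := kernel_ratio (s_src e); first exact: m_s.
  rewrite (H _ kz) sl mulf_neq0 //; apply/eqP => c0.
  by have := m_s (gtgt GX e); rewrite s_step step_end ?s_src // mE c0 sqmod0 mul0r ltxx.
pose phi : {ffun induced_vertex C -> R[i]^o} := [ffun u => z (s (val u))].
have phiE u : phi u = z (s (val u)) by rewrite ffunE.
apply: (@multiplicity_eq1 _ _ _ _ _ phi).
- apply/eqP => phi0; have := zC _ u0C; rewrite -[u0]/(val (Sub u0 u0C : induced_vertex C)).
  by rewrite -phiE phi0 ffunE eqxx.
- move=> u; rewrite !jacobi_induced; case: (kz) => _ /(_ (s (val u))).
  rewrite phiE => <-; rewrite jacobi_cover jacobi_src s_end !extend_val phiE.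
  congr (_ + _); apply: eq_bigr => e /eqP se; congr (_ * _).
  (* Edges leaving [X] contribute nothing, since [z] vanishes over their far ends. *)
  rewrite {1}/extend; case: insubP => [w wX wE|tX] /=; last first.
    by rewrite (ker_vanish kz) // step_end ?s_end // -kernel_supportE.
  have sX : gsrc G e \in X by rewrite se (valP (val u)).
  have [e' e'E] := edge_lift sX wX.
  have us : gsrc GX e' = val u by apply: val_inj; rewrite /= e'E se.
  have ws : gtgt GX e' = w by apply: val_inj; rewrite /= e'E wE.
  have wC : w \in C by rewrite -ws -component_edge us (valP u).
  rewrite -[w]/(val (Sub w wC : induced_vertex C)) extend_val phiE /=.
  by rewrite -ws s_step us e'E.
move=> eta eigen; pose k := extend eta u0 / z (s u0).
suff H u : u \in C -> extend eta u = k * z (s u).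
  by exists k => u; rewrite phiE -H ?(valP u) // extend_val.
rewrite (component_conn _ u0C) => /connectP[q + ->].
elim/last_ind: q => [|q w IH]; first by rewrite /= /k divfK.
rewrite rcons_path last_rcons => /andP[pq /adjacentP[e sl tw]].
have lC : gsrc GX e \in C.
  by rewrite sl (component_conn _ u0C); apply/connectP; exists q.
have {}IH := IH pq; rewrite -sl in IH; rewrite -{}tw.
(* The same edge relation holds for the lift of [eta] ([w1]) and for [z] itself ([w2]); as its
   leading coefficient is nonzero, the ratio [k] found at one end persists at the other. *)
have w1 := wronskian kz (lift_fun_l2 (extend eta)) (s_src e) (fun v => lift_eigen v eigen kz).
have hz v : (z v)^* * (A z v - lam%:C * z v) = 0.
  by case: (kz) => _ ->; rewrite subrr mulr0.
have w2 := wronskian kz (proj1 kz) (s_src e) hz.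
rewrite -s_step !lift_fun_s in w1; rewrite -s_step in w2.
have n0 : (z (s (gsrc GX e)))^*%R * gwt G (ginv G (val e)) != 0.
  by rewrite mulf_neq0 // conjC_eq0 zC.
apply: (mulfI n0); rewrite -mulrA w1 IH.
transitivity (k * ((z (s (gsrc GX e)))^*
  * (gwt G (ginv G (val e)) * z (s (gtgt GX e))))); last by ring.
by rewrite w2; ring.
Qed.

End Multiplicity.

Lemma kernel_support_component_multiplicity (C : {set induced_vertex X}) :
  C \in components GX -> multiplicity (induced_graph GX C) lam = 1%N.
Proof.
move=> compC; have [s [s_end s_step]] := forest_lift r connG kernel_support_acyclic.
exact: (multiplicity_component compC s_end s_step).
Qed.

(** * Summation of the masses over the finite graph *)

Lemma m_vanish u : u \notin X -> m u = 0.
Proof.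
have [p <-] := cover_lift r connG u.
by rewrite kernel_supportE -leNgt => mp; apply/eqP; rewrite eq_le mp m_ge0.
Qed.

(** [M e] is read off at a chosen lift of the source of [e]. The reverse of [e] is read off at
    another chosen lift, and [mass_deck] reconciles the two choices. *)
Lemma edge_masses : exists M : E -> R, [/\
  forall u, 0 < m u -> \sum_(e | gsrc G e == u) M e = 1 - m u,
  forall e, 0 < m (gsrc G e) -> 0 < m (gtgt G e) -> M e + M (ginv G e) = 1
  & forall v : V, v \notin X ->
      \sum_(e | (gsrc G e == v) && (0 < m (gtgt G e))) M (ginv G e)
      = (v \in Defs.boundary G X)%:R].
Proof.
have [L LE] := choice (cover_lift r connG).
exists (fun e => mass (L (gsrc G e)) e).
have Minv p e : gsrc G e = tend p ->
    mass (L (gsrc G (ginv G e))) (ginv G e) = mass (step p e) (ginv G e).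
  by move=> se; apply: mass_deck; rewrite LE // gsrc_inv step_end.
split=> [u mu|e ms mt|v vX].
- have := @mass_sum (L u); rewrite LE => /(_ mu) <-.
  by apply: eq_bigr => e /eqP ->.
- by rewrite (Minv (L (gsrc G e))) ?LE // mass_pair ?LE.
rewrite inE vX /=; case: existsP => [[u /andP[uX /adjacentP[e su tv]]]|no] /=.
  have mv : ~~ (0 < m (tend (L v))) by rewrite LE -kernel_supportE.
  have := @mass_boundary (L v) (ginv G e) mv; rewrite LE gsrc_inv gtgt_inv su.
  rewrite -kernel_supportE uX => /(_ tv isT) <-.
  by apply: eq_bigr => f /andP[/eqP sf _]; rewrite (Minv (L v)) ?LE.
rewrite big1 // => e /andP[/eqP se te]; case: no; exists (gtgt G e).
by rewrite kernel_supportE te; apply/adjacentP; exists (ginv G e); rewrite ?gsrc_inv ?gtgt_inv.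
Qed.

Lemma sum_m : \sum_(u : V) m u
  = #|components GX|%:R - #|Defs.boundary G X|%:R.
Proof.
have [M [M1 M2 M3]] := edge_masses.
have s1 : \sum_(u in X) m u = #|X|%:R - \sum_(e | gsrc G e \in X) M e.
  rewrite (partition_big (gsrc G) (mem X)) //= -sum1_card natr_sum -sumrB.
  apply: eq_bigr => u uX; rewrite (eq_bigl (fun e => gsrc G e == u)) => [|e].
    by rewrite M1 -?kernel_supportE // opprB addrC subrK.
  by case: eqP => [->|]; rewrite ?andbF ?uX.
(* The edges from [X] to its complement are reversed and grouped by their end outside [X]; each
   boundary vertex contributes 1. *)
have s2 : \sum_(e | gsrc G e \in X) M e =
    \sum_(e | (gsrc G e \in X) && (gtgt G e \in X)) M e + #|Defs.boundary G X|%:R.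
  rewrite (bigID (fun e => gtgt G e \in X)) /=; congr (_ + _).
  rewrite (reindex_inj (can_inj (ginvK G))) /=.
  rewrite (eq_bigl (fun e => (gsrc G e \notin X) && (gtgt G e \in X))) => [|e]; last first.
    by rewrite gsrc_inv gtgt_inv andbC.
  rewrite (partition_big (gsrc G) (fun v : V => v \notin X)) /= => [|e /andP[]//].
  rewrite -sum1_card natr_sum [RHS]big_mkcond [LHS]big_mkcond /=.
  apply: eq_bigr => v _; case: ifPn => vX; last first.
    by rewrite negbK in vX; rewrite inE vX.
  transitivity ((v \in Defs.boundary G X)%:R : R); last by case: (v \in _).
  rewrite -M3 //; apply: eq_bigl => e; rewrite -kernel_supportE.
  by case: eqP => [->|]; rewrite ?andbF // vX andbT.
(* Adding to the sum its reindexing by [ginv] pairs every directed edge with its reverse, and each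
   pair has total mass 1. *)
have s3 : 2 * \sum_(e | (gsrc G e \in X) && (gtgt G e \in X)) M e
    = #|{: induced_edge G X}|%:R.
  rewrite card_sig -sum1_card natr_sum mulr2n mulrDl mul1r.
  rewrite {2}(reindex_inj (can_inj (ginvK G))) /=.
  rewrite [X in _ + X](eq_bigl (fun e => (gsrc G e \in X) && (gtgt G e \in X))) => [|e].
    by rewrite -big_split /=; apply: eq_big => // e /andP[]; rewrite !kernel_supportE; exact: M2.
  by rewrite gsrc_inv gtgt_inv andbC.
have := euler_forest kernel_support_acyclic; rewrite card_sig.
rewrite (_ : #|[pred x | x \in X]| = #|X|) // => /(congr1 (fun n => n%:R : R)).
rewrite natrD !natrM => eul.
rewrite (bigID (mem X)) /= [X in _ + X]big1 => [|u]; last exact: m_vanish.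
rewrite addr0 s1 s2; lra.
Qed.

End KernelOnTree.

Theorem theorem3p1 (R : realType) (V E : finType) (G : jgraph R V E)
  (connG : gconnected G) (wt_neq0 : forall e, gwt G e != 0) (r : V)
  (Phi : (R -> R) ->
    (cover_vertex G r -> R[i]) -> (cover_vertex G r -> R[i]))
  (calcPhi : borel_calculus (jacobi (universal_cover G r)) Phi)
  (mu : V -> {measure set R -> \bar R})
  (mu_spec : forall (u : V) (v : cover_vertex G r),
    cover_vmap v = u -> spectral_measure Phi v (mu u))
  (lam : R)
  (lam_spec : point_spectrum (jacobi (universal_cover G r)) lam) :
  let X := aomoto mu lam in
  let GX := induced_graph G X in
  [/\ acyclic GX,
      forall C : {set induced_vertex X}, C \in components GX ->
        multiplicity (induced_graph GX C) lam = 1%N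
    & density_of_states mu [set lam]
      = ((aomoto_index G mu lam)%:~R / #|V|%:R)%:E].
Proof.
pose m := atom lam mu.
have muE u : mu u [set lam] = (m u)%:E.
  by have [p <-] := cover_lift r connG u; case: (mu_atom calcPhi lam mu_spec p).
have xi_diag p := (mu_atom calcPhi lam mu_spec p).2.
(* As the values of [mu] at the singleton are finite, the Aomoto set is the support studied on the
   tree. *)
have XE : aomoto mu lam = kernel_support m.
  by apply/setP => u; rewrite !inE muE lte_fin.
have sym := jacobi_sym calcPhi lam.
have xi_in := repr_kernel_in calcPhi lam.
have xi_repr w z : in_kernel lam z -> inner (repr_kernel Phi lam w) z = z w.
  exact: (inner_repr calcPhi).
have P_in z : l2 z -> in_kernel lam (proj Phi lam z) by exact: (proj_kernel calcPhi lam).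
have xi_P w z : l2 z -> inner (repr_kernel Phi lam w) z = proj Phi lam z w.
  exact: (inner_repr_proj calcPhi).
rewrite /aomoto_index /density_of_states XE; split.
- exact: (kernel_support_acyclic wt_neq0 sym xi_in xi_repr xi_diag connG).
- by move=> C; apply: (kernel_support_component_multiplicity wt_neq0 sym xi_in xi_repr xi_diag connG).
under eq_bigr => u _ do rewrite muE.
rewrite sumEFin -EFinM; congr (_%:E); rewrite mulrC; congr (_ / _).
rewrite (sum_m wt_neq0 sym xi_in xi_repr P_in xi_P xi_diag connG).
by rewrite rmorphB /= -!pmulrn.
Qed.
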